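(* Let $M$ be a $\mathbb{Z}^k$-graded $R$-module. Then $$ \bigcup_i \operatorname{Supp}_{\mathbb{Z}^k}(\operatorname{Tor}_i^R(M,S))^* \;=\; (n_1,\dots,n_k)+\mathbb{C}_{\mathfrak{m}}(M)^*. $$
   Context: $S$ is an arbitrary commutative unitary ring, $k\ge 1$, $n_1,\dots,n_k\ge 1$, and $R=S[X_{i,j} : 1\le i\le k,\ 1\le j\le n_i]$ with its standard $\mathbb{Z}^k$-grading: elements of $S$ have degree $0$ and $\deg X_{i,j}=e_i$, the $i$-th canonical generator of $\mathbb{Z}^k$. $\mathfrak{m}$ is the ideal generated by all the variables $X_{i,j}$, and $S=R/\mathfrak{m}$ as an $R$-module. Modules are not assumed finitely generated. $H^i_{\mathfrak{m}}(M)$ is the $i$-th cohomology of the Čech complex of $M$ with respect to the variables $X_{i,j}$; it is $\mathbb{Z}^k$-graded. For a graded module $N$, $\operatorname{Supp}_{\mathbb{Z}^k}(N)=\{\gamma\in\mathbb{Z}^k : N_\gamma\ne 0\}$. $\mathbb{C}_{\mathfrak{m}}(M)=\bigcup_i \operatorname{Supp}_{\mathbb{Z}^k}(H^i_{\mathfrak{m}}(M))$. For $E\subseteq\mathbb{Z}^k$, $E^*=E-\mathbb{N}^k=\{e-\mu : e\in E,\ \mu\in\mathbb{N}^k\}$, with $\mathbb{N}=\mathbb{Z}_{\ge 0}$; for $v\in\mathbb{Z}^k$, $v+E=\{v+e : e\in E\}$. *)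

(* Defs.v *)
From HB Require Import structures.
From mathcomp Require Import all_boot all_order all_algebra.
From mathcomp Require Import generic_quotient ring_quotient.
From mathcomp Require Import boolp classical_sets.
From mathcomp Require Import zify ring.
From mathcomp Require Import freeg mpoly.

Set Implicit Arguments.
Unset Strict Implicit.
Unset Printing Implicit Defensive.

Import GRing.Theory.
Local Open Scope ring_scope.
Local Open Scope classical_set_scope.
Local Open Scope quotient_scope.

Section Submodules.
Variable R : comNzRingType.

Definition kerp (U V : lmodType R) (f : {linear U -> V}) : {pred U} :=
  fun x => f x == 0.

Fact kerp_closed U V f : submod_closed (@kerp U V f).
Proof.
split=> [|a x y]; rewrite !unfold_in ?linear0 // linearP.
by move=> /eqP-> /eqP->; rewrite scaler0 addr0.
Qed.
HB.instance Definition _ U V f :=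
  GRing.isSubmodClosed.Build R U (@kerp U V f) (@kerp_closed U V f).

Definition imp (U V : lmodType R) (f : {linear U -> V}) : {pred V} :=
  fun y => `[< exists x, f x = y >].

Fact imp_closed U V f : submod_closed (@imp U V f).
Proof.
split=> [|a x y]; first by apply/asboolP; exists 0; rewrite linear0.
move=> /asboolP[u <-] /asboolP[v <-]; apply/asboolP.
by exists (a *: u + v); rewrite linearP.
Qed.
HB.instance Definition _ U V f :=
  GRing.isSubmodClosed.Build R V (@imp U V f) (@imp_closed U V f).

Definition preimp (U V : lmodType R) (f : {linear U -> V})
  (W : submodClosed V) : {pred U} := fun x => f x \in W.

Fact preimp_closed U V f W : submod_closed (@preimp U V f W).
Proof.
split=> [|a x y xW yW]; first by rewrite unfold_in /preimp linear0 rpred0.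
by rewrite unfold_in /preimp linearP rpredD ?rpredZ.
Qed.
HB.instance Definition _ U V f W :=
  GRing.isSubmodClosed.Build R U (@preimp U V f W) (@preimp_closed U V f W).

Definition spanp (V : lmodType R) (A : set V) : {pred V} :=
  fun x => `[< forall W : submodClosed V, (forall a, A a -> a \in W) ->
                 x \in W >].

Fact spanp_closed V A : submod_closed (@spanp V A).
Proof.
split=> [|a x y]; first by apply/asboolP => W _; exact: rpred0.
move=> /asboolP xA /asboolP yA; apply/asboolP => W AW.
by rewrite rpredD ?rpredZ ?xA ?yA.
Qed.
HB.instance Definition _ V A :=
  GRing.isSubmodClosed.Build R V (@spanp V A) (@spanp_closed V A).

Definition subm (V : lmodType R) (W : submodClosed V) := {x : V | x \in W}.

HB.instance Definition _ (V : lmodType R) (W : submodClosed V) := SubChoice.on (@subm V W).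
HB.instance Definition _ (V : lmodType R) (W : submodClosed V) :=
  @GRing.SubChoice_isSubLmodule.Build R V (fun x => x \in W) (@subm V W)
    (submodClosedP W).

Definition submp (V : lmodType R) (W : submodClosed V) : {pred V} :=
  fun x => x \in W.

Fact submp_closed (V : lmodType R) (W : submodClosed V) : zmod_closed (@submp V W).
Proof. exact: GRing.submod_closedB (submodClosedP W). Qed.
HB.instance Definition _ (V : lmodType R) (W : submodClosed V) :=
  GRing.isZmodClosed.Build V (@submp V W) (@submp_closed V W).

Definition quotm (V : lmodType R) (W : submodClosed V) :=
  Quotient.quot (@submp V W : zmodClosed V).

HB.instance Definition _ (V : lmodType R) (W : submodClosed V) := GRing.Zmodule.on (@quotm V W).
HB.instance Definition _ (V : lmodType R) (W : submodClosed V) := Quotient.on (@quotm V W).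

Section QuotientModule.
Variables (V : lmodType R) (W : submodClosed V).

Definition quotm_pi (x : V) : quotm W := \pi x.

Lemma quotm_piP x y : quotm_pi x = quotm_pi y <-> x - y \in W.
Proof.
by split=> [/eqP|xy]; [|apply/eqP]; rewrite -Quotient.idealrBE.
Qed.

Lemma quotm_reprK (q : quotm W) : quotm_pi (repr q) = q.
Proof. exact: reprK. Qed.

Lemma quotm_piB : zmod_morphism quotm_pi.
Proof. by move=> x y; rewrite /quotm_pi !piE. Qed.
HB.instance Definition _ :=
  GRing.isZmodMorphism.Build V (quotm W) quotm_pi quotm_piB.

Definition quotm_scale (a : R) (q : quotm W) : quotm W :=
  quotm_pi (a *: repr q).

Lemma quotm_scale_pi a x : quotm_scale a (quotm_pi x) = quotm_pi (a *: x).
Proof.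
apply/quotm_piP; rewrite -scalerBr rpredZ //.
by apply/quotm_piP; rewrite quotm_reprK.
Qed.

Fact quotm_scalerA a b q :
  quotm_scale a (quotm_scale b q) = quotm_scale (a * b) q.
Proof. by rewrite -[q]quotm_reprK !quotm_scale_pi scalerA. Qed.

Fact quotm_scale1r : left_id 1 quotm_scale.
Proof. by move=> q; rewrite -[q]quotm_reprK quotm_scale_pi scale1r. Qed.

Fact quotm_scalerDr : right_distributive quotm_scale +%R.
Proof.
move=> a p q; rewrite -[p]quotm_reprK -[q]quotm_reprK.
by rewrite -raddfD !quotm_scale_pi scalerDr raddfD.
Qed.

Fact quotm_scalerDl q : {morph quotm_scale^~ q : a b / a + b}.
Proof.
by move=> a b; rewrite -[q]quotm_reprK !quotm_scale_pi scalerDl raddfD.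
Qed.

HB.instance Definition _ :=
  GRing.Zmodule_isLmodule.Build R (quotm W)
    quotm_scalerA quotm_scale1r quotm_scalerDr quotm_scalerDl.

Lemma quotm_piZ : scalable quotm_pi.
Proof. by move=> a x; rewrite -quotm_scale_pi. Qed.
HB.instance Definition _ :=
  GRing.isScalable.Build R V (quotm W) *:%R quotm_pi quotm_piZ.

Section Lift.
Variables (U : lmodType R) (f : {linear V -> U}).
Variable fW : forall x, x \in W -> f x = 0.

Definition quotm_lift (_ : forall x, x \in W -> f x = 0) (q : quotm W) : U :=
  f (repr q).

Lemma quotm_liftE x : quotm_lift fW (quotm_pi x) = f x.
Proof.
apply/eqP; rewrite -subr_eq0 -linearB /=; apply/eqP/fW.
by apply/quotm_piP; rewrite quotm_reprK.
Qed.

Fact quotm_lift_linear : linear (quotm_lift fW).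
Proof.
move=> a p q; rewrite -[p]quotm_reprK -[q]quotm_reprK.
by rewrite -linearP !quotm_liftE linearP.
Qed.
HB.instance Definition _ :=
  GRing.isLinear.Build R (quotm W) U *:%R (quotm_lift fW) quotm_lift_linear.
End Lift.

End QuotientModule.

End Submodules.

Section Graded.
Variables (R : comNzRingType) (G : zmodType).

(* A module together with a family of pieces; [is_graded] below states that
   these are the homogeneous components of a grading. *)
Record gmod := GMod {
  gmod_sort :> lmodType R;
  hcomp : G -> set gmod_sort
}.

(* [RG g] is the component of degree g of the graded ring R. *)
Record is_graded (RG : G -> set R) (M : gmod) : Prop := IsGraded {
  hcomp0 : forall g, hcomp g (0 : M);
  hcompB : forall g (x y : M), hcomp g x -> hcomp g y -> hcomp g (x - y);
  hcompZ : forall g h (a : R) (x : M),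
    RG g a -> hcomp h x -> hcomp (g + h) (a *: x);
  hcomp_span : forall x : M, exists (s : seq G) (c : G -> M),
    (forall g, hcomp g (c g)) /\ x = \sum_(g <- s) c g;
  hcomp_free : forall (s : seq G) (c : G -> M), uniq s ->
    (forall g, hcomp g (c g)) -> \sum_(g <- s) c g = 0 ->
    forall g, g \in s -> c g = 0
}.

Definition Supp (M : gmod) : set G :=
  [set g | exists x : M, hcomp g x /\ x != 0].

Definition subg (M : gmod) (W : submodClosed M) : gmod :=
  @GMod (subm W) (fun g => [set x | hcomp g (val x)]).

Definition quotg (M : gmod) (W : submodClosed M) : gmod :=
  @GMod (quotm W) (fun g => [set quotm_pi W x | x in hcomp g]).

(* The homology ker q / im p at B of a complex A -p-> B -q-> C. *)
Definition homology (A B C : gmod) (p : {linear A -> B}) (q : {linear B -> C}) :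
    gmod :=
  @quotg (subg (kerp q)) (preimp (val : subm (kerp q) -> B) (imp p)).

End Graded.

Section FreeModule.
Variables (R : comNzRingType) (K : choiceType).

Section Lift.
Variables (V : lmodType R) (h : K -> V).

Definition free_lift : {freeg K / R} -> V := fglift h.

Lemma free_liftE D :
  free_lift D = \sum_(k <- dom D) coeff k D *: h k.
Proof.
rewrite -[in LHS](freeg_sumE D) /free_lift.
have h0 : fglift h 0 = 0.
  by have := lift_is_additive h 0 0; rewrite !subrr.
have hB := lift_is_additive h.
have hD x y : fglift h (x + y) = fglift h x + fglift h y.
  by rewrite -{1}[y]opprK hB -[- y]add0r hB h0 add0r opprK.
by rewrite (big_morph _ hD h0); apply: eq_bigr => k _; rewrite liftU.
Qed.

Fact free_lift_linear : linear free_lift.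
Proof.
have widen D (s : seq K) : uniq s -> {subset dom D <= s} ->
    free_lift D = \sum_(k <- s) coeff k D *: h k.
  move=> us Ds; rewrite free_liftE.
  rewrite [RHS](bigID (mem (dom D))) /= [X in _ + X]big1 ?addr0; last first.
    by move=> k kD; rewrite coeff_outdom ?scale0r.
  rewrite -[RHS]big_filter; apply: perm_big; apply: uniq_perm.
  - exact: uniq_dom.
  - exact: filter_uniq.
  - by move=> k; rewrite mem_filter /= andb_idr //; apply: Ds.
move=> a D E.
pose s := undup (dom (a *: D + E) ++ dom D ++ dom E).
have us : uniq s by exact: undup_uniq.
rewrite (widen _ s us); last by move=> k kD; rewrite mem_undup mem_cat kD.
rewrite (widen D s us); last first.
  by move=> k kD; rewrite mem_undup !mem_cat kD orbT.
rewrite (widen E s us); last first.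
  by move=> k kD; rewrite mem_undup !mem_cat kD !orbT.
rewrite scaler_sumr -big_split /=; apply: eq_bigr => k _.
by rewrite coeffD coeffZ scalerDl scalerA.
Qed.
HB.instance Definition _ :=
  GRing.isLinear.Build R {freeg K / R} V *:%R free_lift free_lift_linear.
End Lift.

End FreeModule.

Section Tensor.
Variable R : comNzRingType.

Section TensorModule.
Variables N L : lmodType R.

Local Notation F := {freeg (N * L)%type / R}.

Definition tens_gen (n : N) (l : L) : F := << (n, l) >>.

Inductive tens_rel : F -> Prop :=
| TensDl n n' l :
    tens_rel (tens_gen (n + n') l - tens_gen n l - tens_gen n' l)
| TensDr n l l' :
    tens_rel (tens_gen n (l + l') - tens_gen n l - tens_gen n l')
| TensZl a n l : tens_rel (tens_gen (a *: n) l - a *: tens_gen n l)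
| TensZr a n l : tens_rel (tens_gen n (a *: l) - a *: tens_gen n l).

Definition tens : lmodType R := quotm (spanp tens_rel : submodClosed F).

Definition tens_pure (n : N) (l : L) : tens :=
  quotm_pi (spanp tens_rel : submodClosed F) (tens_gen n l).

Lemma tens_genP x : tens_rel x -> x \in spanp tens_rel.
Proof. by move=> xr; apply/asboolP => W; apply. Qed.

Lemma tens_pureDl n n' l : tens_pure (n + n') l = tens_pure n l + tens_pure n' l.
Proof.
rewrite /tens_pure -raddfD; apply/quotm_piP.
by rewrite opprD addrA; exact/tens_genP/TensDl.
Qed.

Lemma tens_pureDr n l l' : tens_pure n (l + l') = tens_pure n l + tens_pure n l'.
Proof.
rewrite /tens_pure -raddfD; apply/quotm_piP.
by rewrite opprD addrA; exact/tens_genP/TensDr.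
Qed.

Lemma tens_pureZl a n l : tens_pure (a *: n) l = a *: tens_pure n l.
Proof.
by rewrite /tens_pure -linearZ; exact/quotm_piP/tens_genP/TensZl.
Qed.

Lemma tens_pureZr a n l : tens_pure n (a *: l) = a *: tens_pure n l.
Proof.
by rewrite /tens_pure -linearZ; exact/quotm_piP/tens_genP/TensZr.
Qed.

End TensorModule.

Section TensorMap.
Variables (N N' L : lmodType R) (f : {linear N -> N'}).

Definition tens_map_gen : {linear {freeg (N * L)%type / R} -> tens N' L} :=
  free_lift (fun p => tens_pure (f p.1) p.2).

Lemma free_lift_gen (V : lmodType R) (h : N * L -> V) n l :
  free_lift h (tens_gen n l) = h (n, l).
Proof. by rewrite /free_lift /tens_gen liftU scale1r. Qed.

Lemma tens_map_gen0 x :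
  x \in spanp (@tens_rel N L) -> tens_map_gen x = 0.
Proof.
move=> /asboolP xW; suff: x \in kerp tens_map_gen by move=> /eqP.
have mapE n l : tens_map_gen (tens_gen n l) = tens_pure (f n) l.
  exact: free_lift_gen.
apply: xW => _ [n n' l|n l l'|a n l|a n l]; apply/eqP.
- by rewrite !linearB !mapE linearD tens_pureDl addrAC addrK subrr.
- by rewrite !linearB !mapE tens_pureDr addrAC addrK subrr.
- by rewrite linearB linearZ !mapE linearZ tens_pureZl subrr.
- by rewrite linearB linearZ !mapE tens_pureZr subrr.
Qed.

Definition tens_map : {linear tens N L -> tens N' L} :=
  quotm_lift tens_map_gen0.

Lemma tens_mapE n l : tens_map (tens_pure n l) = tens_pure (f n) l.
Proof.
by rewrite [LHS](quotm_liftE tens_map_gen0) /= free_lift_gen.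
Qed.

End TensorMap.
End Tensor.

Section Tor.
Variables (R : comNzRingType) (G : zmodType) (RG : G -> set R).

Local Notation gmod := (gmod R G).

(* Degree g: sums of tensors of homogeneous elements with degrees adding up
   to g. *)
Definition tensg (N L : gmod) : gmod :=
  @GMod R G (tens N L) (fun g => [set t | exists s : seq (G * (N * L)),
    (forall u, u \in s -> hcomp u.1 u.2.1 /\ hcomp (g - u.1) u.2.2) /\
    t = \sum_(u <- s) tens_pure u.2.1 u.2.2]).

Record garrow := GArrow {
  gsrc : gmod;
  gtgt : gmod;
  gfun :> {linear gsrc -> gtgt}
}.

Definition hker (u : garrow) :=
  {p : G * gsrc u | `[< hcomp p.1 p.2 /\ u p.2 = 0 >]}.

(* Free with one generator in degree g for each (g, x) in [hker u]. *)
Definition hker_free (u : garrow) : gmod :=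
  @GMod R G {freeg (hker u) / R}
    (fun g => [set D | forall k, RG (g - (val k).1) (coeff k D)]).

Definition hker_cover (u : garrow) : garrow :=
  @GArrow (hker_free u) (gsrc u) (free_lift (fun k => (val k).2)).

(* A graded free resolution ... -> F_1 -> F_0 -> M -> 0, where [fres M i] is
   the arrow out of F_i: F_0 covers M and F_(i+1) covers the kernel of the
   arrow out of F_i. *)
Definition fres (M : gmod) (i : nat) : garrow :=
  iter i.+1 hker_cover (@GArrow M M \0).

Definition fres_mod (M : gmod) (i : nat) : gmod := gsrc (fres M i).

Definition fres_d (M : gmod) (i : nat) :
  {linear fres_mod M i.+1 -> fres_mod M i} := gfun (fres M i.+1).

Definition fres_aug (M : gmod) : {linear fres_mod M 0 -> M} := gfun (fres M 0).

Lemma hker_cover_comp (u : garrow) D : u (hker_cover u D) = 0.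
Proof.
rewrite /= free_liftE linear_sum big1 // => k _.
by rewrite linearZ /=; have /asboolP[_ ->] := valP k; rewrite scaler0.
Qed.

Definition Tor (M L : gmod) (i : nat) : gmod :=
  let T j := tensg (fres_mod M j) L in
  let d j : {linear T j.+1 -> T j} := tens_map L (fres_d M j) in
  match i with
  | 0 => @homology R G (T 1) (T 0) (T 0) (d 0) \0
  | j.+1 => @homology R G (T j.+2) (T j.+1) (T j) (d j.+1) (d j)
  end.

End Tor.

Section Localization.
Variables (R : comNzRingType) (V : lmodType R) (f : R).

(* (m, a) stands for m / f ^ a. *)
Definition frac := (V * nat)%type.
HB.instance Definition _ := Choice.on frac.

Definition frac_eqv (p q : frac) : bool :=
  `[< exists c, f ^+ (c + q.2) *: p.1 = f ^+ (c + p.2) *: q.1 >].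

Lemma frac_eqv_is_equiv : equiv_class_of frac_eqv.
Proof.
have sym p q : frac_eqv p q -> frac_eqv q p.
  by move=> /asboolP[c e]; apply/asboolP; exists c.
split=> [p|p q|q p r]; first by apply/asboolP; exists 0.
  by apply/idP/idP; exact: sym.
move=> /asboolP[c e] /asboolP[d e']; apply/asboolP; exists (c + d + q.2)%N.
have -> : (c + d + q.2 + r.2 = (d + r.2) + (c + q.2))%N by lia.
rewrite exprD -scalerA e scalerA -exprD.
have -> : (d + r.2 + (c + p.2) = (c + p.2) + (d + r.2))%N by lia.
rewrite exprD -scalerA e' scalerA -exprD.
by congr (f ^+ _ *: _); lia.
Qed.

Canonical frac_equiv := EquivRelPack frac_eqv_is_equiv.
Canonical frac_encModRel := defaultEncModRel frac_eqv.

Definition loc := {eq_quot frac_eqv}.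
HB.instance Definition _ := Choice.on loc.
HB.instance Definition _ : EqQuotient frac frac_eqv loc := EqQuotient.on loc.

Definition mkfrac (m : V) (a : nat) : loc := \pi_loc ((m, a) : frac).

Lemma mkfracP m a m' a' : mkfrac m a = mkfrac m' a' <->
  exists c, f ^+ (c + a') *: m = f ^+ (c + a) *: m'.
Proof.
split=> [/eqP|e]; first by rewrite /mkfrac piE => /asboolP.
by apply/eqP; rewrite /mkfrac piE; apply/asboolP.
Qed.

Lemma loc_reprK (q : loc) : mkfrac (repr q).1 (repr q).2 = q.
Proof. by rewrite /mkfrac -surjective_pairing reprK. Qed.

Lemma loc_repr m a :
  exists c, f ^+ (c + a) *: (repr (mkfrac m a)).1 =
            f ^+ (c + (repr (mkfrac m a)).2) *: m.
Proof. by apply/mkfracP; rewrite loc_reprK. Qed.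

Definition loc_add (p q : loc) : loc :=
  mkfrac (f ^+ (repr q).2 *: (repr p).1 + f ^+ (repr p).2 *: (repr q).1)
         ((repr p).2 + (repr q).2).

Definition loc_scale (r : R) (q : loc) : loc :=
  mkfrac (r *: (repr q).1) (repr q).2.

Lemma loc_addE m a m' a' : loc_add (mkfrac m a) (mkfrac m' a') =
  mkfrac (f ^+ a' *: m + f ^+ a *: m') (a + a').
Proof.
apply/mkfracP.
have [c e] := loc_repr m a; have [d e'] := loc_repr m' a'.
move: (repr _).1 (repr _).2 e => n b e.
move: (repr _).1 (repr _).2 e' => n' b' e'.
exists (c + d)%N; rewrite !scalerDr !scalerA -!exprD; congr (_ + _).
  have -> : (c + d + (a + a') + b' = (d + a' + b') + (c + a))%N by lia.
  by rewrite exprD -scalerA e scalerA -exprD; congr (f ^+ _ *: _); lia.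
have -> : (c + d + (a + a') + b = (c + a + b) + (d + a'))%N by lia.
by rewrite exprD -scalerA e' scalerA -exprD; congr (f ^+ _ *: _); lia.
Qed.

Lemma loc_scaleE r m a : loc_scale r (mkfrac m a) = mkfrac (r *: m) a.
Proof.
apply/mkfracP; have [c e] := loc_repr m a; exists c.
have sC (x y : R) (v : V) : x *: (y *: v) = y *: (x *: v).
  by rewrite !scalerA mulrC.
by rewrite (sC _ r) e (sC r).
Qed.

Fact loc_addA : associative loc_add.
Proof.
move=> p q r; rewrite -[p]loc_reprK -[q]loc_reprK -[r]loc_reprK.
move: (repr p) (repr q) (repr r) => [m a] [m' b] [m'' c] /=.
rewrite !loc_addE !scalerDr !scalerA -!exprD addrA addnA.
by rewrite [(c + a)%N]addnC [(c + b)%N]addnC.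
Qed.

Fact loc_addC : commutative loc_add.
Proof.
move=> p q; rewrite -[p]loc_reprK -[q]loc_reprK.
by rewrite !loc_addE addrC addnC.
Qed.

Fact loc_add0 : left_id (mkfrac 0 0) loc_add.
Proof.
move=> p; rewrite -[p]loc_reprK loc_addE.
by rewrite scaler0 add0r expr0 scale1r.
Qed.

Fact loc_addN : left_inverse (mkfrac 0 0) (loc_scale (-1)) loc_add.
Proof.
move=> p; rewrite -[p]loc_reprK loc_scaleE loc_addE scaleN1r scalerN addNr.
by apply/mkfracP; exists 0; rewrite !scaler0.
Qed.

HB.instance Definition _ :=
  GRing.isZmodule.Build loc loc_addA loc_addC loc_add0 loc_addN.

Fact loc_scalerA a b q : loc_scale a (loc_scale b q) = loc_scale (a * b) q.
Proof. by rewrite -[q]loc_reprK !loc_scaleE scalerA. Qed.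

Fact loc_scale1r : left_id 1 loc_scale.
Proof. by move=> q; rewrite -[q]loc_reprK loc_scaleE scale1r. Qed.

Fact loc_scalerDr : right_distributive loc_scale +%R.
Proof.
move=> r p q; rewrite -[p]loc_reprK -[q]loc_reprK.
rewrite [_ + _]loc_addE !loc_scaleE [RHS]loc_addE scalerDr !scalerA.
by rewrite ![r * _]mulrC.
Qed.

Fact loc_scalerDl q : {morph loc_scale^~ q : a b / a + b}.
Proof.
move=> r s; rewrite -[q]loc_reprK !loc_scaleE [RHS]loc_addE.
apply/mkfracP; exists 0; rewrite -scalerDr -scalerDl [RHS]scalerA -exprD.
by congr (f ^+ _ *: _); lia.
Qed.

HB.instance Definition _ :=
  GRing.Zmodule_isLmodule.Build R loc
    loc_scalerA loc_scale1r loc_scalerDr loc_scalerDl.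

Lemma mkfracD m a m' a' : mkfrac m a + mkfrac m' a' =
  mkfrac (f ^+ a' *: m + f ^+ a *: m') (a + a').
Proof. exact: loc_addE. Qed.

Lemma mkfracZ r m a : r *: mkfrac m a = mkfrac (r *: m) a.
Proof. exact: loc_scaleE. Qed.

End Localization.

Section LocalizationMap.
Variables (R : comNzRingType) (V : lmodType R) (f g h : R).

(* The canonical map V_f -> V_g for g = f h, sending m / f ^ a to
   h ^ a m / g ^ a. *)
Definition loc_map (q : loc V f) : loc V g :=
  mkfrac g (h ^+ (repr q).2 *: (repr q).1) (repr q).2.

Variable gE : g = f * h.

Lemma loc_mapE m a : loc_map (mkfrac f m a) = mkfrac g (h ^+ a *: m) a.
Proof.
apply/mkfracP; have [c e] := loc_repr f m a; exists c; rewrite gE.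
move: (repr _).1 (repr _).2 e => n b e.
rewrite !exprMn !scalerA -!mulrA -!exprD [f ^+ (c + a) * _]mulrC.
rewrite [f ^+ (c + b) * _]mulrC -!scalerA e.
by congr (h ^+ _ *: _); lia.
Qed.

Lemma loc_map_linear : linear loc_map.
Proof.
move=> r p q; rewrite -[p]loc_reprK -[q]loc_reprK.
move: (repr p) (repr q) => [m a] [m' b] /=.
rewrite mkfracZ mkfracD !loc_mapE mkfracZ mkfracD; congr mkfrac.
by rewrite gE !exprMn scalerDr !scalerA exprD; congr (_ *: _ + _ *: _); ring.
Qed.

End LocalizationMap.

Section Product.
Variables (R : comNzRingType) (I : Type) (V : I -> lmodType R).

Definition prodm := forall i, V i.
HB.instance Definition _ := Choice.copy prodm (forall i, V i).

Definition prodm_zero : prodm := fun i => 0.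
Definition prodm_opp (c : prodm) : prodm := fun i => - c i.
Definition prodm_add (c d : prodm) : prodm := fun i => c i + d i.
Definition prodm_scale (a : R) (c : prodm) : prodm := fun i => a *: c i.

Fact prodm_addA : associative prodm_add.
Proof. by move=> c d e; apply: functional_extensionality_dep => i; exact: addrA. Qed.
Fact prodm_addC : commutative prodm_add.
Proof. by move=> c d; apply: functional_extensionality_dep => i; exact: addrC. Qed.
Fact prodm_add0 : left_id prodm_zero prodm_add.
Proof. by move=> c; apply: functional_extensionality_dep => i; exact: add0r. Qed.
Fact prodm_addN : left_inverse prodm_zero prodm_opp prodm_add.
Proof. by move=> c; apply: functional_extensionality_dep => i; exact: addNr. Qed.
HB.instance Definition _ :=
  GRing.isZmodule.Build prodm prodm_addA prodm_addC prodm_add0 prodm_addN.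

Fact prodm_scalerA a b c :
  prodm_scale a (prodm_scale b c) = prodm_scale (a * b) c.
Proof. by apply: functional_extensionality_dep => i; exact: scalerA. Qed.
Fact prodm_scale1r : left_id 1 prodm_scale.
Proof. by move=> c; apply: functional_extensionality_dep => i; exact: scale1r. Qed.
Fact prodm_scalerDr : right_distributive prodm_scale +%R.
Proof. by move=> a c d; apply: functional_extensionality_dep => i; exact: scalerDr. Qed.
Fact prodm_scalerDl c : {morph prodm_scale^~ c : a b / a + b}.
Proof. by move=> a b; apply: functional_extensionality_dep => i; exact: scalerDl. Qed.
HB.instance Definition _ := GRing.Zmodule_isLmodule.Build R prodm
  prodm_scalerA prodm_scale1r prodm_scalerDr prodm_scalerDl.

End Product.

Section Cech.
Variables (R : comNzRingType) (G : zmodType).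

(* The degree g part of M_f, for f homogeneous of degree df. *)
Definition loc_hcomp (M : gmod R G) (f : R) (df g : G) : set (loc M f) :=
  [set q | exists m a, hcomp (g + df *+ a) m /\ q = mkfrac f m a].

Section CechComplex.
(* x v is meant to be homogeneous of degree dx v. *)
Variables (N : nat) (x : 'I_N -> R) (dx : 'I_N -> G) (M : gmod R G).

(* The cochains of degree p form the sum of the M_{x_s} over the p-subsets s
   of the index set, where x_s is the product of the x v for v in s. *)
Definition face (p : nat) := {s : {set 'I_N} | #|s| == p}.

Definition xprod (s : {set 'I_N}) : R := \prod_(v in s) x v.

Definition cech (p : nat) : gmod R G :=
  @GMod R G (prodm (fun s : face p => loc M (xprod (val s)) : lmodType R))
    (fun g => [set c | forall s : face p,
       loc_hcomp (\sum_(v in val s) dx v) g (c s)]).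

(* When t = s :|: [set v] with v \notin s, this is the position of v in the
   increasing enumeration of t. *)
Definition cech_pos (s t : {set 'I_N}) : nat :=
  #|[set u in s | [exists v in t :\: s, (u < v)%N]]|.

Definition cech_fun (p : nat) (c : cech p) : cech p.+1 := fun t =>
  \sum_(s : face p | val s \subset val t)
    (-1) ^+ cech_pos (val s) (val t) *:
      loc_map (xprod (val t)) (xprod (val t :\: val s)) (c s).

Lemma xprodD (s t : {set 'I_N}) : s \subset t ->
  xprod t = xprod s * xprod (t :\: s).
Proof.
by move=> st; rewrite /xprod (big_setID s) /=; move/finset.setIidPr: st => ->.
Qed.

Fact cech_fun_linear p : linear (@cech_fun p).
Proof.
move=> a c c'; apply: functional_extensionality_dep => t.
change (cech_fun (a *: c + c') t = a *: cech_fun c t + cech_fun c' t).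
rewrite /cech_fun scaler_sumr -big_split /=.
apply: eq_bigr => s st.
change ((a *: c + c') s) with (a *: c s + c' s).
rewrite (loc_map_linear (xprodD st)).
by rewrite scalerDr !scalerA mulrC.
Qed.
HB.instance Definition _ p :=
  GRing.isLinear.Build R (cech p) (cech p.+1) *:%R (@cech_fun p)
    (@cech_fun_linear p).

Definition cech_d (p : nat) : {linear cech p -> cech p.+1} := @cech_fun p.

Definition cech_cohomology (i : nat) : gmod R G :=
  match i with
  | 0 => @homology R G (cech 0) (cech 0) (cech 1) \0 (cech_d 0)
  | j.+1 => @homology R G (cech j) (cech j.+1) (cech j.+2)
              (cech_d j) (cech_d j.+1)
  end.

End CechComplex.
End Cech.

Section MultigradedPolynomials.
Variables (S : comNzRingType) (k : nat) (n : 'I_k -> nat).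

(* The variable X_{i,j} is 'X_(tagnat.Rank i j); conversely 'X_v belongs to
   the block [tagnat.sig1 v]. *)
Definition mring : comNzRingType := {mpoly S[\sum_(i < k) n i]}.

Definition vardeg (v : 'I_(\sum_(i < k) n i)) : 'rV[int]_k :=
  delta_mx 0 (tagnat.sig1 v).

Definition mondeg (m : 'X_{1..\sum_(i < k) n i}) : 'rV[int]_k :=
  \sum_v vardeg v *+ m v.

Definition mring_comp (g : 'rV[int]_k) : set mring :=
  [set p | forall m, m \in msupp p -> mondeg m = g].

Definition mvar (v : 'I_(\sum_(i < k) n i)) : mring := 'X_v.

Definition mring_gmod : gmod mring 'rV[int]_k := @GMod mring _ mring^o mring_comp.

Definition irrelevant_ideal : submodClosed mring^o :=
  spanp (range mvar : set mring^o).

Definition base_gmod : gmod mring 'rV[int]_k :=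
  @quotg mring _ mring_gmod irrelevant_ideal.

Definition local_cohomology (M : gmod mring 'rV[int]_k) (i : nat) :
  gmod mring 'rV[int]_k := cech_cohomology mvar vardeg M i.

Definition cohomology_supp (M : gmod mring 'rV[int]_k) : set 'rV[int]_k :=
  \bigcup_i Supp (local_cohomology M i).

End MultigradedPolynomials.

Section Cones.
Variable k : nat.

Definition estar (E : set 'rV[int]_k) : set 'rV[int]_k :=
  [set e - mu | e in E & mu in [set mu : 'rV[int]_k | forall i, 0 <= mu 0 i]].

Definition translate (v : 'rV[int]_k) (E : set 'rV[int]_k) : set 'rV[int]_k :=
  [set v + e | e in E].

End Cones.

(* Main.v *)
Require Import Defs.
From HB Require Import structures.
From mathcomp Require Import all_boot all_order all_algebra.
From mathcomp Require Import boolp classical_sets.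
From mathcomp Require Import freeg mpoly.

(** Both sides are compared with the Koszul complex of the variables on [M],
    degree by degree. If multiplication by a homogeneous [x] is regular on a
    complex modulo a subcomplex, the fiber of [x] is the quotient by [x], up to
    a shift of degrees by [deg x]; applied to a graded free resolution [F] of
    [M], which is equivalent to [M], this identifies the Koszul homology in
    degree [g] with the homology of [F / mF], that is Tor, in degree [g + n].
    On the other side, the Cech complex [C] maps onto [M], with a kernel
    filtered by subquotients on which some variable is bijective, so that the
    Koszul complexes of [C] and [M] are equivalent. Finally the homology of [C]
    is torsion with respect to each variable, and the fiber of [x] on a complex
    with [x]-torsion homology is acyclic above an up-closed set of degrees if
    and only if the complex is. Hence Tor vanishes on [g + n + NN^k] if and
    only if local cohomology vanishes on [g + NN^k]. *)

Set Implicit Arguments.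
Unset Strict Implicit.
Unset Printing Implicit Defensive.

Import GRing.Theory.
Local Open Scope ring_scope.

(** * Koszul complexes *)

Section Koszul.
Variables (G : zmodType) (I : eqType) (deg : I -> G).

(** A degree [e] lies in [E^*] exactly when [E] meets [e + NN^k], so each side of the theorem is
    determined by the up-closed sets of degrees on which the relevant modules vanish. Single degrees
    would be too fine: the fiber of [x] in degree [g] involves the degrees [g] and [g + deg x], and
    the way back multiplies a class by [x] until it dies. Since only unions over [i] occur, the
    homological index is forgotten: a complex becomes one group with a differential, whose
    acyclicity in a multidegree expresses the vanishing of all its homology there. Quotients are
    pairs of predicates on a fixed group, so that dividing by a variable or discarding an acyclic
    piece only changes the predicate that plays the role of zero. *)

Record dgm := Dgm {
  dgm_sort :> zmodType;
  dif : {additive dgm_sort -> dgm_sort};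
  act : I -> {additive dgm_sort -> dgm_sort};
  dif_dif : forall x, dif (dif x) = 0;
  dif_act : forall v x, dif (act v x) = act v (dif x);
  actC : forall u v x, act u (act v x) = act v (act u x)
}.

Record gsub (C : dgm) (A : G -> C -> Prop) : Prop := GSub {
  gsub0 : forall g, A g 0;
  gsubB : forall g x y, A g x -> A g y -> A g (x - y);
  gsub_dif : forall g x, A g x -> A g (dif C x);
  gsub_act : forall g v x, A g x -> A (g + deg v) (act C v x)
}.

Section IteratedAction.
Variable C : dgm.

Definition actn n v (x : C) : C := iter n (act C v) x.

Fact actn_sub n v : zmod_morphism (actn n v).
Proof. by move=> x y; elim: n => //= n ->; rewrite raddfB. Qed.
HB.instance Definition _ n v :=
  GRing.isZmodMorphism.Build C C (actn n v) (actn_sub n v).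

Lemma actn_act n u w x : actn n u (act C w x) = act C w (actn n u x).
Proof. by elim: n => //= n ->; rewrite actC. Qed.

Lemma actn_dif n u x : actn n u (dif C x) = dif C (actn n u x).
Proof. by elim: n => //= n ->; rewrite dif_act. Qed.

Lemma actnD m n u x : actn (m + n) u x = actn m u (actn n u x).
Proof. exact: iterD. Qed.
End IteratedAction.

Section GsubTheory.
Variables (C : dgm) (A : G -> C -> Prop) (gA : gsub A).

Lemma gsubN g x : A g x -> A g (- x).
Proof. by rewrite -sub0r; apply: gsubB => //; exact: gsub0. Qed.

Lemma gsubD g x y : A g x -> A g y -> A g (x + y).
Proof. by move=> Ax Ay; rewrite -[y]opprK; apply: gsubB => //; exact: gsubN. Qed.

Lemma gsub_actn g v n x : A g x -> A (g + deg v *+ n) (actn n v x).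
Proof.
by move=> Ax; elim: n => [|n IHn]; rewrite ?addr0 // mulrSr addrA; exact: gsub_act.
Qed.
End GsubTheory.

(* Acyclicity in degree [g] of the quotient of [A] by [Z]. *)
Definition acyc (C : dgm) (A Z : G -> C -> Prop) (g : G) : Prop :=
  forall c, A g c -> Z g (dif C c) -> exists2 b, A g b & Z g (c - dif C b).

Definition incl (C : dgm) (Z A : G -> C -> Prop) : Prop :=
  forall g x, Z g x -> A g x.

(** This is the long exact homology sequence of [Z' / Z], [A / Z] and [A / Z'] when the first term
    is acyclic; the differential preserves degrees, so a single [g] suffices. *)
Lemma acyc_quot (C : dgm) (A Z' Z : G -> C -> Prop) g :
  gsub A -> gsub Z' -> gsub Z -> incl Z Z' -> incl Z' A ->
  acyc Z' Z g -> acyc A Z g <-> acyc A Z' g.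
Proof.
move=> gA gZ' gZ ZZ' Z'A aZ; split=> aA c Ac dc.
  (* [dif C c] is a cycle of [Z'], hence a boundary [dif C z] modulo [Z]; then [c - z] is a cycle
     modulo [Z]. *)
  have [z Z'z] := aZ _ dc (eq_ind_r _ (gsub0 gZ g) (dif_dif c)).
  rewrite -raddfB => dcz.
  have [b Ab Zb] := aA _ (gsubB gA Ac (Z'A _ _ Z'z)) dcz.
  exists b => //; have := gsubD gZ' (ZZ' _ _ Zb) Z'z.
  by rewrite addrAC subrK.
have [b Ab Zb] := aA _ Ac (ZZ' _ _ dc).
have dcb : Z g (dif C (c - dif C b)) by rewrite raddfB dif_dif subr0.
have [z Zz Zcz] := aZ _ Zb dcb.
exists (b + z); first exact: (gsubD gA Ab (Z'A _ _ Zz)).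
by rewrite raddfD opprD addrA.
Qed.

(** * The fiber of multiplication by a variable *)

Section Fiber.
Variables (v : I) (C : dgm).

(* The sign convention makes the second projection a chain map modulo the
   image of [act C v]. *)
Definition fib_dif (c : C * C) : C * C := (- dif C c.1, act C v c.1 + dif C c.2).
Definition fib_act (u : I) (c : C * C) : C * C := (act C u c.1, act C u c.2).

Fact fib_dif_sub : zmod_morphism fib_dif.
Proof.
move=> [a b] [a' b']; congr (_, _) => /=; first by rewrite raddfB opprB opprK addrC.
by rewrite !raddfB opprD addrACA.
Qed.
HB.instance Definition _ :=
  GRing.isZmodMorphism.Build (C * C)%type (C * C)%type fib_dif fib_dif_sub.

Fact fib_act_sub u : zmod_morphism (fib_act u).
Proof. by move=> [a b] [a' b']; congr (_, _); rewrite /= raddfB. Qed.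
HB.instance Definition _ u :=
  GRing.isZmodMorphism.Build (C * C)%type (C * C)%type (fib_act u) (fib_act_sub u).

Fact fib_difK x : fib_dif (fib_dif x) = 0.
Proof.
case: x => a b; congr (_, _) => /=.
  by rewrite (raddfN (dif C)) dif_dif !oppr0.
by rewrite raddfN raddfD dif_dif dif_act addr0 addNr.
Qed.

Fact fib_dif_act u x : fib_dif (fib_act u x) = fib_act u (fib_dif x).
Proof.
case: x => a b; congr (_, _); rewrite /= ?dif_act.
  by rewrite (raddfN (act C u)).
by rewrite raddfD actC.
Qed.

Fact fib_actC u w x : fib_act u (fib_act w x) = fib_act w (fib_act u x).
Proof. by case: x => a b; congr (_, _); rewrite /= actC. Qed.

Definition fib : dgm := Dgm fib_difK fib_dif_act fib_actC.

(** The second coordinate is shifted so that [act C v c.1] and [dif C c.2] have the same degree. *)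
Definition fibp (A : G -> C -> Prop) (g : G) (c : fib) : Prop :=
  A g c.1 /\ A (g + deg v) c.2.

Lemma fib_gsub A : gsub A -> gsub (fibp A).
Proof.
move=> gA; split=> [g|g [a b] [a' b'] [/= Aa Ab] [/= Aa' Ab']|g [a b] [/= Aa Ab]|
    g u [a b] [/= Aa Ab]].
- by split; exact: gsub0.
- by split; exact: gsubB.
- split; first by apply: (gsubN gA); exact: gsub_dif.
  by apply: gsubD => //; [exact: gsub_act | exact: gsub_dif].
- by split; rewrite /= 1?addrAC; exact: gsub_act.
Qed.

Lemma fib_incl Z A : incl Z A -> incl (fibp Z) (fibp A).
Proof. by move=> ZA g [a b] [/ZA Aa /ZA Ab]. Qed.

Lemma fib_acyc A Z g : gsub A -> gsub Z ->
  acyc A Z g -> acyc A Z (g + deg v) -> acyc (fibp A) (fibp Z) g.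
Proof.
move=> gA gZ a1 a2 [a b] [/= Aa Ab] [/= Zda Zdb].
have [|a' Aa' Za'] := a1 a Aa; first by rewrite -[dif _ _]opprK; exact: gsubN.
have [||b' Ab' Zb'] := a2 (b + act C v a').
- by apply: gsubD => //; exact: gsub_act.
- suff -> : dif C (b + act C v a') =
      (act C v a + dif C b) - act C v (a - dif C a').
    by apply: gsubB => //; exact: gsub_act.
  rewrite (raddfB (act C v)) (raddfD (dif C)) dif_act.
  by rewrite opprB [RHS]addrC addrA subrK addrC.
exists (- a', b') => //; first by split=> //; exact: gsubN.
split; first by rewrite /= (raddfN (dif C)) opprK.
by rewrite /= (raddfN (act C v)) opprD opprK addrA.
Qed.

Definition torsion u (A Z : G -> C -> Prop) : Prop :=
  forall g c, A g c -> Z g (dif C c) ->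
  exists n b, A (g + deg u *+ n) b /\
              Z (g + deg u *+ n) (actn n u c - dif C b).

(** Acyclicity of the fiber in degree [g] makes [v] injective on homology from degree [g] to degree
    [g + deg v]. A power of [v] kills the class of [c], and the induction removes one factor at a
    time; it passes through higher degrees, whence the closure of [U]. *)
Lemma acyc_of_fib (U : G -> Prop) A Z : gsub A -> gsub Z -> torsion v A Z ->
  (forall g, U g -> U (g + deg v)) ->
  (forall g, U g -> acyc (fibp A) (fibp Z) g) -> forall g, U g -> acyc A Z g.
Proof.
move=> gA gZ tA Uv aF g Ug c Ac dc; have [n [b [Ab Zb]]] := tA g c Ac dc.
elim: n => [|n IHn] in g Ug c Ac dc b Ab Zb *.
  by exists b; move: Ab Zb; rewrite /= addr0.
have [|||||b' Ab' Zb'] := IHn (g + deg v) _ (act C v c) _ _ b.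
- exact: Uv.
- exact: gsub_act.
- by rewrite dif_act; exact: gsub_act.
- by rewrite -addrA -mulrS.
- by rewrite -addrA -mulrS /actn -iterSr.
(* A primitive [b'] of [act C v c] makes [(c, - b')] a cycle of the fiber; up to sign, the first
   coordinate of its primitive is a primitive of [c]. *)
have [||[x y] [/= Ax Ay] [/= Zx Zy]] := aF g Ug (c, - b').
- by split=> //; exact: gsubN.
- split; first by apply: gsubN.
  by rewrite /= (raddfN (dif C)).
exists (- x); first exact: gsubN.
by rewrite (raddfN (dif C)).
Qed.

Lemma fib_actn n u (c : fib) : actn n u c = (actn n u c.1, actn n u c.2).
Proof. by elim: n => [|n /= ->]; first by case: c. Qed.

End Fiber.

(** The homology of the fiber is caught between two torsion groups, so exponents add up: [n] for the
    first coordinate, then [m] for the second. *)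
Lemma fib_torsion v u (C : dgm) (A Z : G -> C -> Prop) :
  gsub A -> gsub Z -> torsion u A Z ->
  torsion u (@fibp v C A) (@fibp v C Z).
Proof.
move=> gA gZ tA g [a b] [/= Aa Ab] [/= Zda Zdb].
have [|n [a' [Aa' Za']]] := tA g a Aa.
  by rewrite -[dif _ _]opprK; exact: gsubN.
(* Subtracting the boundary of [(- a', 0)] from [u^n (a, b)] leaves zero modulo [Z] in the first
   coordinate and [b1] in the second. *)
set b1 := actn n u b + act C v a'.
have Ab1 : A (g + deg v + deg u *+ n) b1.
  apply: gsubD => //; first exact: gsub_actn.
  by rewrite addrAC; exact: gsub_act.
have [|m [b' [Ab' Zb']]] := tA _ _ Ab1.
  have := gsub_actn gZ u n Zdb; rewrite addrAC => Zdb'.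
  suff -> : dif C b1 =
      actn n u (act C v a + dif C b) - act C v (actn n u a - dif C a').
    by apply: (gsubB gZ); [exact: Zdb' | exact: (gsub_act gZ)].
  rewrite (raddfB (act C v)) (raddfD (dif C)) dif_act -actn_dif -actn_act.
  by rewrite (raddfD (actn n u)) opprB [RHS]addrC addrA subrK addrC.
have E : g + deg u *+ (m + n) = g + deg u *+ n + deg u *+ m.
  by rewrite mulrnDr -addrA [_ *+ m + _]addrC.
have E' : g + deg u *+ n + deg u *+ m + deg v =
          g + deg v + deg u *+ n + deg u *+ m.
  by rewrite addrAC [g + _ + deg v]addrAC.
exists (m + n)%N, (- actn m u a', b').
rewrite fib_actn !actnD E /fibp /= E'.
split; split=> //.
- by apply: gsubN => //; exact: gsub_actn.
- rewrite (raddfN (dif C)) !opprK -actn_dif -(raddfB (actn m u)).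
  exact: gsub_actn.
rewrite (raddfN (act C v)) opprD opprK addrA -actn_act.
by rewrite -(raddfD (actn m u)).
Qed.

(* [act C u] is bijective on the quotient of [A] by [Z]. *)
Record act_bij (C : dgm) u (A Z : G -> C -> Prop) : Prop := ActBij {
  act_bij_inj : forall g x, A g x -> Z (g + deg u) (act C u x) -> Z g x;
  act_bij_surj : forall g y, A (g + deg u) y ->
    exists2 x, A g x & Z (g + deg u) (y - act C u x)
}.

Lemma fib_act_bij v u (C : dgm) (A Z : G -> C -> Prop) :
  act_bij u A Z -> act_bij u (@fibp v C A) (@fibp v C Z).
Proof.
move=> [inj surj]; split=> g [a b] [/= Aa Ab].
  case=> /= Za; rewrite addrAC => Zb.
  by split; exact: inj.
have [x Ax Zx] := surj _ _ Aa.
rewrite addrAC in Ab; have [y Ay Zy] := surj _ _ Ab.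
by exists (x, y); split=> //=; rewrite addrAC.
Qed.

(** The fiber of an isomorphism is acyclic: a preimage [x] of the second coordinate gives the
    primitive [(x, 0)], and its first coordinate can be checked after applying the injective
    [act C v]. *)
Lemma act_bij_acyc v (C : dgm) (A Z : G -> C -> Prop) g :
  gsub A -> gsub Z -> act_bij v A Z -> acyc (@fibp v C A) (@fibp v C Z) g.
Proof.
move=> gA gZ [inj surj] [a b] [/= Aa Ab] [/= Zda Zdb].
have [x Ax Zx] := surj _ _ Ab.
have Zax : Z g (a + dif C x).
  apply: inj; first by apply: (gsubD gA) => //; exact: (gsub_dif gA).
  suff -> : act C v (a + dif C x) =
      (act C v a + dif C b) - dif C (b - act C v x).
    by apply: (gsubB gZ) => //; exact: (gsub_dif gZ).
  rewrite (raddfD (act C v)) (raddfB (dif C)) dif_act.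
  by rewrite opprB addrACA subrr addr0.
exists (x, 0); first by split=> //; exact: gsub0.
by split; rewrite /= ?opprK // raddf0 addr0.
Qed.

(* [act C v] is regular on the quotient of [A] by [Z], and [Z'] is the
   preimage of the image of [act C v]. *)
Record act_reg (C : dgm) v (A Z Z' : G -> C -> Prop) : Prop := ActReg {
  act_reg_inj : forall g x, A g x -> Z (g + deg v) (act C v x) -> Z g x;
  act_reg_sub : forall g x, Z g x -> Z' g x;
  act_reg_im : forall g x, A g x -> Z' (g + deg v) (act C v x);
  act_reg_out : forall g y, Z' (g + deg v) y ->
    exists2 x, A g x & Z (g + deg v) (y - act C v x)
}.

(** Regularity makes [act C v] an isomorphism from [A / Z] onto its image [Z' / Z], and the
    subcomplex here is the fiber of that isomorphism. *)
Lemma act_reg_acyc v (C : dgm) (A Z Z' : G -> C -> Prop) g :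
  gsub A -> gsub Z -> act_reg v A Z Z' ->
  acyc (fun g (c : fib v C) => A g c.1 /\ Z' (g + deg v) c.2) (@fibp v C Z) g.
Proof.
move=> gA gZ [inj sub im out] [a b] [/= Aa Zb] [/= Zda Zdb].
have [x Ax Zx] := out _ _ Zb.
have Zax : Z g (a + dif C x).
  apply: inj; first by apply: (gsubD gA) => //; exact: (gsub_dif gA).
  suff -> : act C v (a + dif C x) =
      (act C v a + dif C b) - dif C (b - act C v x).
    by apply: (gsubB gZ) => //; exact: (gsub_dif gZ).
  rewrite (raddfD (act C v)) (raddfB (dif C)) dif_act.
  by rewrite opprB addrACA subrr addr0.
exists (x, 0); first by split=> //; apply: sub; exact: gsub0.
by split; rewrite /= ?opprK // raddf0 addr0.
Qed.

(** An isomorphism of quotients, not merely of homology: [f] induces a bijection of [A / Z] onto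
    [A' / Z']. Compatibility with differentials is asked only modulo [Z'], because maps such as the
    second projection of a fiber satisfy no more. *)
Record qiso (C C' : dgm) (f : {additive C -> C'}) (e : G)
    (A Z : G -> C -> Prop) (A' Z' : G -> C' -> Prop) : Prop := QIso {
  qiso_hom : forall g x, A g x -> A' (g + e) (f x);
  qiso_ker : forall g x, A g x -> Z' (g + e) (f x) <-> Z g x;
  qiso_surj : forall g y, A' (g + e) y ->
    exists2 x, A g x & Z' (g + e) (y - f x);
  qiso_dif : forall g x, A g x -> Z' (g + e) (f (dif C x) - dif C' (f x));
  qiso_act : forall g v x, A g x ->
    Z' (g + e + deg v) (f (act C v x) - act C' v (f x))
}.

Lemma qiso_acyc (C C' : dgm) (f : {additive C -> C'}) e A Z A' Z' g :
  gsub A -> gsub Z -> gsub A' -> gsub Z' ->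
  qiso f e A Z A' Z' -> acyc A Z g <-> acyc A' Z' (g + e).
Proof.
move=> gA gZ gA' gZ' [hom ker surj fd _]; split=> aA c Ac dc.
  have [a Aa Za] := surj _ _ Ac.
  have [|b Ab Zb] := aA a Aa.
    apply/ker; first exact: gsub_dif.
    suff -> : f (dif C a) = f (dif C a) - dif C' (f a) + dif C' c - dif C' (c - f a).
      apply: (gsubB gZ'); last exact: (gsub_dif gZ').
      by apply: (gsubD gZ'); first exact: fd.
    by rewrite (raddfB (dif C')) opprB addrA addrAC addrK subrK.
  exists (f b); first exact: hom.
  have /ker Zf := gsubB gA Aa (gsub_dif gA Ab).
  suff -> : c - dif C' (f b) =
      c - f a + f (a - dif C b) + (f (dif C b) - dif C' (f b)).
    by apply: (gsubD gZ'); [apply: (gsubD gZ') => //; exact: Zf.2 | exact: fd].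
  by rewrite (raddfB f) !addrA !subrK.
have Zdf : Z' (g + e) (dif C' (f c)).
  have /ker Zf := gsub_dif gA Ac.
  suff -> : dif C' (f c) = f (dif C c) - (f (dif C c) - dif C' (f c)).
    by apply: (gsubB gZ'); [exact: Zf.2 | exact: fd].
  by rewrite opprB addrC subrK.
have [b' Ab' Zb'] := aA _ (hom _ _ Ac) Zdf.
have [b Ab Zb] := surj _ _ Ab'.
exists b => //; apply/ker; first by apply: (gsubB gA) => //; exact: (gsub_dif gA).
suff -> : f (c - dif C b) = f c - dif C' b' + dif C' (b' - f b) -
    (f (dif C b) - dif C' (f b)).
  apply: (gsubB gZ'); last exact: fd.
  by apply: (gsubD gZ') => //; exact: (gsub_dif gZ').
by rewrite (raddfB f) (raddfB (dif C')) opprB !addrA !subrK.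
Qed.

(** * Iterated fibers *)

Section FiberMap.
Variables (v : I) (C C' : dgm) (f : {additive C -> C'}).

Definition fib_map (c : fib v C) : fib v C' := (f c.1, f c.2).

Fact fib_map_sub : zmod_morphism fib_map.
Proof. by move=> [a b] [a' b']; congr (_, _); rewrite /= raddfB. Qed.
HB.instance Definition _ :=
  GRing.isZmodMorphism.Build (fib v C) (fib v C') fib_map fib_map_sub.

Lemma fib_qiso e A Z A' Z' : gsub Z' -> qiso f e A Z A' Z' ->
  qiso fib_map e (@fibp v C A) (@fibp v C Z) (@fibp v C' A') (@fibp v C' Z').
Proof.
move=> gZ' [hom ker surj fd fX].
have E g : g + e + deg v = g + deg v + e by rewrite addrAC.
split=> [g [a b] [/= Aa Ab]|g [a b] [/= Aa Ab]|g [a b]|g [a b] [/= Aa Ab]|g u [a b] [/= Aa Ab]];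
  rewrite /fibp /= ?E.
- by split; exact: hom.
- by rewrite (ker _ _ Aa) (ker _ _ Ab).
- case=> Aa Ab; have [x Ax Zx] := surj _ _ Aa; have [y Ay Zy] := surj _ _ Ab.
  by exists (x, y); rewrite /= ?E.
- rewrite (raddfN f) -opprD; split; first by apply: (gsubN gZ'); exact: fd.
  rewrite (raddfD f) opprD addrACA -E; apply: (gsubD gZ'); first exact: fX.
  by rewrite E; exact: fd.
- split; first exact: fX.
  by rewrite addrAC E; exact: fX.
Qed.
End FiberMap.

(** The Koszul complex as an iterated fiber, so that statements about it reduce by induction to a
    single fiber. *)
Fixpoint kos (l : seq I) (C : dgm) : dgm :=
  if l is v :: l' then kos l' (fib v C) else C.

Fixpoint kosp (l : seq I) (C : dgm) (A : G -> C -> Prop) : G -> kos l C -> Prop :=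
  if l is v :: l' then kosp (l := l') (@fibp v C A) else A.

Lemma kos_gsub l (C : dgm) (A : G -> C -> Prop) : gsub A -> gsub (@kosp l C A).
Proof. by elim: l C A => //= v l IHl C A gA; apply: IHl; exact: fib_gsub. Qed.

Lemma kos_incl l (C : dgm) (Z A : G -> C -> Prop) :
  incl Z A -> incl (@kosp l C Z) (@kosp l C A).
Proof. by elim: l C Z A => //= v l IHl C Z A ZA; apply: IHl; exact: fib_incl. Qed.

Lemma kos_acyc l (C : dgm) (A Z : G -> C -> Prop) : gsub A -> gsub Z ->
  (forall g, acyc A Z g) -> forall g, acyc (@kosp l C A) (@kosp l C Z) g.
Proof.
elim: l C A Z => //= v l IHl C A Z gA gZ aA.
by apply: IHl => [||g]; [exact: fib_gsub..| exact: fib_acyc].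
Qed.

Lemma kos_acyc_quot l (C : dgm) (A Z' Z : G -> C -> Prop) g :
  gsub A -> gsub Z' -> gsub Z -> incl Z Z' -> incl Z' A ->
  (forall h, acyc (@kosp l C Z') (@kosp l C Z) h) ->
  acyc (@kosp l C A) (@kosp l C Z) g <-> acyc (@kosp l C A) (@kosp l C Z') g.
Proof.
move=> gA gZ' gZ ZZ' Z'A a; apply: acyc_quot => //; try exact: kos_gsub.
  exact: kos_incl.
exact: kos_incl.
Qed.

(** Bijectivity of [v] survives the fibers taken before its own; the fiber of [v] is then acyclic,
    and the remaining fibers keep it so. *)
Lemma kos_act_bij l v (C : dgm) (A Z : G -> C -> Prop) : gsub A -> gsub Z ->
  act_bij v A Z -> v \in l -> forall g, acyc (@kosp l C A) (@kosp l C Z) g.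
Proof.
elim: l C A Z => //= u l IHl C A Z gA gZ bA; rewrite inE => /orP[/eqP uv|vl].
  subst u; apply: kos_acyc => [||g]; try exact: fib_gsub.
  exact: act_bij_acyc.
by apply: IHl => //; [exact: fib_gsub..| exact: fib_act_bij].
Qed.

(** A fiber inherits torsion with respect to every variable, so the two directions for one fiber,
    [fib_acyc] and [acyc_of_fib], can be iterated. *)
Lemma kos_torsion (U : G -> Prop) l (C : dgm) (A Z : G -> C -> Prop) :
  gsub A -> gsub Z -> (forall v, torsion v A Z) ->
  (forall g v, U g -> U (g + deg v)) ->
  (forall g, U g -> acyc A Z g) <->
  (forall g, U g -> acyc (@kosp l C A) (@kosp l C Z) g).
Proof.
move=> gA gZ tA UU; elim: l C A Z gA gZ tA => //= v l IHl C A Z gA gZ tA.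
rewrite -IHl; try exact: fib_gsub; last by move=> u; exact: fib_torsion.
split=> aA g Ug; first by apply: fib_acyc => //; apply: aA => //; exact: UU.
by apply: (acyc_of_fib (v := v) (U := U)) => // h; exact: UU.
Qed.

Lemma kos_qiso l (C C' : dgm) (f : {additive C -> C'}) e A Z A' Z' g :
  gsub A -> gsub Z -> gsub A' -> gsub Z' -> qiso f e A Z A' Z' ->
  acyc (@kosp l C A) (@kosp l C Z) g <->
  acyc (@kosp l C' A') (@kosp l C' Z') (g + e).
Proof.
elim: l C C' f A Z A' Z' => [|v l IHl] C C' f A Z A' Z' gA gZ gA' gZ' q /=.
  exact: (qiso_acyc g gA gZ gA' gZ' q).
apply: (IHl _ _ (fib_map f : {additive fib v C -> fib v C'})); try exact: fib_gsub.
exact: fib_qiso.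
Qed.

(** The second projection maps the fiber onto [A / Z'], in degree [g + deg v] because of the shift
    in [fibp]. *)
Lemma kos_act_reg l v (C : dgm) (A Z Z' : G -> C -> Prop) g :
  gsub A -> gsub Z -> gsub Z' -> incl Z' A -> act_reg v A Z Z' ->
  acyc (@kosp (v :: l) C A) (@kosp (v :: l) C Z) g <->
  acyc (@kosp l C A) (@kosp l C Z') (g + deg v).
Proof.
move=> gA gZ gZ' Z'A rA /=.
(* The kernel of the projection; modulo [fibp Z] it is the fiber of an isomorphism, hence
   acyclic. *)
pose Y g (c : fib v C) := A g c.1 /\ Z' (g + deg v) c.2.
have gY : gsub Y.
  split=> [h|h [a b] [a' b'] [/= Aa Ab] [/= Aa' Ab']|h [a b] [/= Aa Ab]|h u [a b] [/= Aa Ab]].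
  - by split; exact: gsub0.
  - by split; exact: gsubB.
  - split; first by apply: (gsubN gA); exact: (gsub_dif gA).
    apply: (gsubD gZ'); last exact: (gsub_dif gZ').
    exact: (act_reg_im rA).
  - by split; rewrite /= 1?addrAC; exact: gsub_act.
have ZY : incl (@fibp v C Z) Y.
  move=> h [a b] [/= Za Zb]; split; last exact: (act_reg_sub rA Zb).
  exact: (Z'A _ _ (act_reg_sub rA Za)).
have YA : incl Y (@fibp v C A) by move=> h [a b] [/= Aa /Z'A].
rewrite (kos_acyc_quot g (fib_gsub _ gA) gY (fib_gsub _ gZ) ZY YA); last first.
  by apply: kos_acyc => // [|h]; [exact: fib_gsub | exact: act_reg_acyc].
apply: (@kos_qiso l (fib v C) C snd) => //; first exact: fib_gsub.
split=> [h [a b] [] //|h [a b] [/= Aa Ab]|h b Ab|h [a b] [/= Aa Ab]|h u [a b] _] /=.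
- by split=> [|[]].
- by exists (0, b); [split=> //; exact: gsub0 | rewrite subrr; exact: gsub0].
- by rewrite addrK; exact: (act_reg_im rA).
- by rewrite subrr; exact: gsub0.
Qed.

End Koszul.

(** [Z U] stands for the part generated by the variables in [U]. A variable outside [U] is regular
    modulo [Z U], so the variables of [l] form a regular sequence modulo [Z T], and their degrees
    accumulate. *)
Lemma kos_regular_seq (G : zmodType) (I : finType) (deg : I -> G) (C : dgm I)
    (A : G -> C -> Prop) (Z : {set I} -> G -> C -> Prop) (l : seq I) (T : {set I}) g :
  gsub deg A -> (forall U, gsub deg (Z U)) -> (forall U, incl (Z U) A) ->
  (forall (U : {set I}) v, v \notin U -> act_reg deg v A (Z U) (Z (v |: U))) ->
  uniq l -> all [predC T] l ->
  acyc (@kosp _ _ deg l C A) (@kosp _ _ deg l C (Z T)) g <->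
  acyc A (Z (T :|: [set v in l])) (g + \sum_(v <- l) deg v).
Proof.
move=> gA gZ ZA rZ; elim: l T g => [|v l IHl] T g.
  by rewrite big_nil addr0 finset.set_nil finset.setU0.
move=> /= /andP[vl ul] /andP[vT lT].
rewrite (kos_act_reg l g gA (gZ T) (gZ (v |: T)) (ZA _) (rZ _ _ vT)).
rewrite IHl //; last first.
  apply/allP => u ul'; have /allP/(_ u ul') := lT; rewrite !inE negb_or => ->.
  by rewrite andbT; apply: contraNneq vl => <-.
by rewrite big_cons addrA finset.set_cons finset.setUCA finset.setUA.
Qed.

(** * The Cech complex *)

(** The excluded primitives [x] are arbitrary, whereas [acyc] asks for a homogeneous one;
    [homogeneous_preimage] bridges the gap. *)
Lemma homology_SuppP (R : comNzRingType) (G : zmodType) (A B C : gmod R G)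
    (p : {linear A -> B}) (q : {linear B -> C}) g :
  Supp (homology p q) g <->
  exists y : B, [/\ hcomp g y, q y = 0 & forall x, p x <> y].
Proof.
split.
  move=> [_ [[y hy <-] ny]]; exists (val y); split=> //.
    by have := valP y; rewrite /in_mem /= => /eqP.
  move=> x pxy; move/eqP: ny; apply.
  rewrite -(raddf0 (quotm_pi _)); apply/quotm_piP; rewrite subr0.
  by apply/asboolP; exists x.
move=> [y [hy qy ny]].
have yk : y \in kerp q by apply/eqP.
exists (quotm_pi _ (Sub y yk : subm (kerp q))); split; first by exists (Sub y yk).
apply/eqP; rewrite -(raddf0 (quotm_pi _)) => /quotm_piP.
rewrite subr0 => /asboolP[x px].
by apply: (ny x); rewrite px.
Qed.

(** The degree [g] component of a primitive is again a primitive, provided that [Z] contains the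
    homogeneous components of its elements. *)
Lemma homogeneous_preimage (G U V : zmodType) (A : G -> U -> Prop)
    (B : G -> V -> Prop) (Z : V -> Prop) (p : {additive U -> V}) :
  (forall g, A g 0) -> (forall g x y, A g x -> A g y -> A g (x + y)) ->
  (forall g, B g 0) -> (forall g x y, B g x -> B g y -> B g (x - y)) ->
  (forall g x, A g x -> B g (p x)) ->
  (forall (s : seq G) (c : G -> V), uniq s -> (forall g, B g (c g)) ->
    Z (\sum_(g <- s) c g) -> forall g, g \in s -> Z (c g)) ->
  forall g y (l : seq (G * U)), B g y -> (forall u, u \in l -> A u.1 u.2) ->
  Z (y - p (\sum_(u <- l) u.2)) -> exists2 b, A g b & Z (y - p b).
Proof.
move=> A0 AD B0 BB pAB freeZ g y l By Al Zy.
(* [g] is included so that [y] has a slot even when no summand has degree [g]; [c h] merges the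
   summands of degree [h]. *)
pose s := undup (g :: map fst l).
pose c h := \sum_(u <- l | u.1 == h) u.2.
have Ac h : A h (c h).
  rewrite /c big_seq_cond; apply: (big_ind (A h)) => [||u /andP[ul /eqP <-]] //.
    exact: AD.
  exact: Al.
exists (c g) => //.
suff : Z (\sum_(h <- s) ((if h == g then y else 0) - p (c h))).
  move/(freeZ s (fun h => (if h == g then y else 0) - p (c h)) (undup_uniq _)).
  move=> /(_ _ g); rewrite eqxx; apply; last by rewrite mem_undup mem_head.
  by move=> h; apply: BB; [case: eqP => [->|] | exact: pAB].
rewrite sumrB -(raddf_sum p); move: Zy; congr (Z (_ - p _)).
  rewrite (bigD1_seq g) /= ?undup_uniq ?mem_undup ?mem_head // eqxx big1 ?addr0 //.
  by move=> h /negbTE ->.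
rewrite /c (exchange_big_dep xpredT) //= big_seq [RHS]big_seq.
apply: eq_bigr => u ul; under eq_bigl do rewrite eq_sym.
rewrite -big_filter filter_pred1_uniq ?undup_uniq ?big_seq1 //.
by rewrite mem_undup inE map_f ?orbT.
Qed.

Section CechCube.
Variables (R : comNzRingType) (G : zmodType) (RG : G -> set R).
Variables (N : nat) (x : 'I_N -> R) (dx : 'I_N -> G) (M : gmod R G).
Hypothesis xdx : forall v, RG (dx v) (x v).
Hypothesis M_graded : is_graded RG M.

Local Notation xp := (xprod x).
Local Notation V s := (loc M (xp s)).

Definition face_deg (s : {set 'I_N}) : G := \sum_(v in s) dx v.

Lemma face_degD (s t : {set 'I_N}) : s \subset t ->
  face_deg t = face_deg s + face_deg (t :\: s).
Proof.
by move=> st; rewrite /face_deg (big_setID s) /=; move/finset.setIidPr: st => ->.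
Qed.

Lemma hcompD g (m m' : M) : hcomp g m -> hcomp g m' -> hcomp g (m + m').
Proof.
move=> hm hm'; rewrite -[m']opprK -[- m']sub0r.
by apply: (hcompB M_graded) => //; apply: (hcompB M_graded) => //; exact: (hcomp0 M_graded).
Qed.

Lemma hcomp_var g v (m : M) : hcomp g m -> hcomp (g + dx v) (x v *: m).
Proof. by rewrite addrC; apply: (hcompZ M_graded); exact: xdx. Qed.

Lemma hcomp_xprod g s (m : M) : hcomp g m -> hcomp (g + face_deg s) (xp s *: m).
Proof.
rewrite /face_deg /xprod => hm; elim/big_rec2: _ => [|v a d _].
  by rewrite addr0 scale1r.
by rewrite addrCA addrC -scalerA; exact: hcomp_var.
Qed.

Lemma hcomp_xprodX g s a (m : M) :
  hcomp g m -> hcomp (g + face_deg s *+ a) (xp s ^+ a *: m).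
Proof.
move=> hm; elim: a => [|a IHa]; first by rewrite addr0 scale1r.
by rewrite mulrSr addrA exprS -scalerA; exact: hcomp_xprod.
Qed.

Lemma mkfrac_expand (W : lmodType R) (f : R) (m : W) a b :
  mkfrac f m a = mkfrac f (f ^+ b *: m) (b + a).
Proof. by apply/mkfracP; exists 0; rewrite scalerA -exprD !add0n addnC. Qed.

Lemma mkfrac0 (W : lmodType R) (f : R) a : mkfrac f (0 : W) a = 0.
Proof. by apply/mkfracP; exists 0; rewrite !scaler0. Qed.

Lemma mkfrac_eq0 (W : lmodType R) (f : R) (m : W) a :
  mkfrac f m a = 0 <-> exists c, f ^+ c *: m = 0.
Proof.
rewrite -(mkfrac0 W f 0); split=> [/mkfracP|] [c e].
  by exists (c + 0)%N; rewrite e scaler0.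
by apply/mkfracP; exists c; rewrite addn0 e scaler0.
Qed.

Lemma mkfracDl (W : lmodType R) (f : R) (m m' : W) a :
  mkfrac f m a + mkfrac f m' a = mkfrac f (m + m') a.
Proof. by rewrite mkfracD -scalerDr -mkfrac_expand. Qed.

Local Notation vcomp s := (@loc_hcomp R G M (xp s) (face_deg s)).

Lemma vcomp0 s g : vcomp s g 0.
Proof. by exists 0, 0; split; [exact: (hcomp0 M_graded) | rewrite mkfrac0]. Qed.

Lemma vcompZ s g r c : (forall h (m : M), hcomp h m -> hcomp (h + r) (c *: m)) ->
  forall q : V s, vcomp s g q -> vcomp s (g + r) (c *: q).
Proof.
move=> hc q [m [a [hm ->]]]; exists (c *: m), a; rewrite mkfracZ; split=> //.
by rewrite addrAC; exact: hc.
Qed.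

Lemma vcompD s g (p q : V s) : vcomp s g p -> vcomp s g q -> vcomp s g (p + q).
Proof.
move=> [m [a [hm ->]]] [m' [a' [hm' ->]]]; rewrite mkfracD.
exists (xp s ^+ a' *: m + xp s ^+ a *: m'), (a + a')%N; split=> //.
apply: hcompD; first by rewrite mulrnDr addrA; exact: hcomp_xprodX.
by rewrite mulrnDr addrA addrAC; exact: hcomp_xprodX.
Qed.

Lemma hcompN g (m : M) : hcomp g m -> hcomp g (- m).
Proof.
by move=> hm; rewrite -sub0r; apply: (hcompB M_graded) => //; exact: (hcomp0 M_graded).
Qed.

Lemma vcompN s g (q : V s) : vcomp s g q -> vcomp s g (- q).
Proof.
move=> [m [a [hm ->]]]; exists (- m), a; split; first exact: hcompN.
by rewrite -[LHS]scaleN1r mkfracZ scaleN1r.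
Qed.

Lemma vcompB s g (p q : V s) : vcomp s g p -> vcomp s g q -> vcomp s g (p - q).
Proof. by move=> hp hq; apply: vcompD => //; exact: vcompN. Qed.

Lemma vcomp_sign s g b (q : V s) : vcomp s g q -> vcomp s g ((-1) ^+ b *: q).
Proof.
by rewrite -signr_odd; case: (odd b); rewrite ?expr0 ?scale1r ?expr1 ?scaleN1r //;
  exact: vcompN.
Qed.

Lemma vcomp_sum s g (J : Type) (r : seq J) (P : pred J) (F : J -> V s) :
  (forall j, P j -> vcomp s g (F j)) -> vcomp s g (\sum_(j <- r | P j) F j).
Proof. by move=> hF; apply: big_ind => //; [exact: vcomp0 | exact: vcompD]. Qed.

(** * The total Cech complex on the cube of subsets *)

Definition kap (s t : {set 'I_N}) : V s -> V t := loc_map (xp t) (xp (t :\: s)).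

Lemma kapE (s t : {set 'I_N}) m a : s \subset t ->
  kap t (mkfrac (xp s) m a) = mkfrac (xp t) (xp (t :\: s) ^+ a *: m) a.
Proof. by move=> st; rewrite /kap loc_mapE // -xprodD. Qed.

Lemma kap_linear (s t : {set 'I_N}) : s \subset t -> linear (@kap s t).
Proof. by move=> st; apply: loc_map_linear; exact: xprodD. Qed.

Lemma kap0 (s t : {set 'I_N}) : s \subset t -> kap t (0 : V s) = 0.
Proof.
move=> st; apply: (addrI (kap t (0 : V s))).
by have := kap_linear st 1 0 0; rewrite !scale1r !addr0.
Qed.

Lemma kapD (s t : {set 'I_N}) (p q : V s) : s \subset t ->
  kap t (p + q) = kap t p + kap t q.
Proof. by move=> st; have := kap_linear st 1 p q; rewrite !scale1r. Qed.

Lemma kapZ (s t : {set 'I_N}) a (q : V s) : s \subset t ->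
  kap t (a *: q) = a *: kap t q.
Proof. by move=> st; have := kap_linear st a q 0; rewrite kap0 // !addr0. Qed.

Lemma kap_comp (s t u : {set 'I_N}) (q : V s) : s \subset t -> t \subset u ->
  kap u (kap t q) = kap u q.
Proof.
move=> st tu; rewrite -[q]loc_reprK !kapE //; last exact: (fintype.subset_trans st tu).
rewrite scalerA -exprMn; congr (mkfrac _ (_ ^+ _ *: _) _).
have su := fintype.subset_trans st tu.
have -> : u :\: t = (u :\: s) :\: (t :\: s).
  apply/finset.setP => v; rewrite !inE; case: (boolP (v \in s)) => [vs|//].
  by rewrite (fintype.subsetP st).
rewrite [RHS](@xprodD _ _ _ (t :\: s)); first by rewrite mulrC.
exact: finset.setSD.
Qed.

Lemma vcomp_kap (s t : {set 'I_N}) g (q : V s) : s \subset t -> vcomp s g q -> vcomp t g (kap t q).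
Proof.
move=> st [m [a [hm ->]]]; rewrite kapE //; eexists; exists a; split=> //.
by rewrite (face_degD st) mulrnDl addrA; exact: hcomp_xprodX.
Qed.

(** All Cech groups at once, indexed by subsets of every size, so that the differential need not
    mention cardinalities. *)
Definition cube : lmodType R :=
  prodm (fun s : {set 'I_N} => loc M (xp s) : lmodType R).

Definition cube_dif (c : cube) : cube := fun t =>
  \sum_(v in t) (-1) ^+ cech_pos (t :\ v) t *: kap t (c (t :\ v)).

Fact cube_dif_linear : linear cube_dif.
Proof.
move=> a c c'; apply: functional_extensionality_dep => t.
change (cube_dif (a *: c + c') t = a *: cube_dif c t + cube_dif c' t).
rewrite /cube_dif scaler_sumr -big_split /=; apply: eq_bigr => v vt.
change ((a *: c + c') (t :\ v)) with (a *: c (t :\ v) + c' (t :\ v)).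
by rewrite (kap_linear (subD1set _ _)) scalerDr !scalerA mulrC.
Qed.
HB.instance Definition _ :=
  GRing.isLinear.Build R cube cube *:%R cube_dif cube_dif_linear.

Lemma cech_posE (t : {set 'I_N}) v : v \in t ->
  cech_pos (t :\ v) t = #|[set u in t | (u < v)%N]|.
Proof.
move=> vt; rewrite /cech_pos.
have -> : t :\: (t :\ v) = [set v]%SET.
  by apply/finset.setP => u; rewrite !inE; case: eqVneq => [->|_] /=; rewrite ?vt ?andNb.
apply: eq_card => u; rewrite !inE.
have -> : [exists w in [set v]%SET, (u < w)%N] = (u < v)%N.
  apply/existsP/idP => [[w]|uv]; first by rewrite inE => /andP[/eqP->].
  by exists v; rewrite inE eqxx.
by case: eqVneq => [->|]; rewrite ?ltnn ?andbF.
Qed.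

(** Removing the larger index [v] leaves the position of [w] unchanged, whereas removing [w] lowers
    the position of [v] by one. *)
Lemma cech_pos_anti (t : {set 'I_N}) (v w : 'I_N) (r : R) : v \in t -> w \in t -> (w < v)%N ->
  (-1) ^+ cech_pos (t :\ v) t * (-1) ^+ cech_pos (t :\ v :\ w) (t :\ v) =
  - ((-1) ^+ cech_pos (t :\ w) t * (-1) ^+ cech_pos (t :\ w :\ v) (t :\ w)) :> R.
Proof.
move=> vt wt wv; have vw : v != w by rewrite -val_eqE /= gtn_eqF.
rewrite !cech_posE // ?inE ?vw ?vt 1?eq_sym ?vw //.
have -> : #|[set u in t :\ v | (u < w)%N]| = #|[set u in t | (u < w)%N]|.
  apply: eq_card => u; rewrite !inE; case: eqVneq => [->|//].
  by rewrite ltnNge ltnW ?andbF.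
rewrite (cardsD1 w [set u in t | (u < v)%N]) inE wt wv /=.
have -> : [set u in t | (u < v)%N] :\ w = [set u in t :\ w | (u < v)%N].
  by apply/finset.setP => u; rewrite !inE andbA.
by rewrite exprS mulN1r mulNr mulrC.
Qed.

Lemma cube_dif_dif c : cube_dif (cube_dif c) = 0.
Proof.
apply: functional_extensionality_dep => t.
change (cube_dif (cube_dif c) t = 0).
pose H v w : V t := ((-1) ^+ cech_pos (t :\ v) t *
   (-1) ^+ cech_pos (t :\ v :\ w) (t :\ v)) *: kap t (c (t :\ v :\ w)).
have sub2 v w : t :\ v :\ w \subset t.
  by apply: fintype.subset_trans (subD1set _ _) (subD1set _ _).
have E : cube_dif (cube_dif c) t =
    \sum_(v in t) \sum_(w in t | w != v) H v w.
  rewrite {1}/cube_dif; apply: eq_bigr => v vt.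
  rewrite /cube_dif (big_morph _ (fun p q => kapD p q (subD1set t v)) (kap0 (subD1set t v))).
  rewrite scaler_sumr.
  apply: eq_big => [w|w]; first by rewrite !inE andbC.
  move=> wt; by rewrite kapZ ?subD1set // scalerA kap_comp ?subD1set.
have anti v w : v \in t -> w \in t -> (w < v)%N -> H v w = - H w v.
  move=> vt wt wv; rewrite /H (cech_pos_anti 0 vt wt wv) scaleNr.
  by congr (- (_ *: _)); rewrite finset.setDDl finset.setUC -finset.setDDl.
have -> : cube_dif (cube_dif c) t = \sum_(v in t) \sum_(w in t | (w < v)%N) H v w +
    \sum_(v in t) \sum_(w in t | (v < w)%N) H v w.
  rewrite E -big_split /=; apply: eq_bigr => v vt.
  rewrite (bigID (fun w : 'I_N => (w < v)%N)) /=; congr (_ + _).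
    apply: eq_bigl => w; rewrite -andbA; congr (_ && _).
    by rewrite -val_eqE /= neq_ltn; case: ltnP; rewrite ?andbF.
  apply: eq_bigl => w; rewrite -andbA; congr (_ && _).
  by rewrite -val_eqE /= neq_ltn -leqNgt; case: ltngtP.
rewrite [X in _ + X](exchange_big_dep (mem t)) /=; last by move=> ? ? ? /andP[].
rewrite -big_split big1 //= => v vt.
rewrite [X in _ + X](eq_bigl (fun w => (w \in t) && (w < v)%N)); last first.
  by move=> w; rewrite vt.
rewrite -big_split big1 //= => w /andP[wt wv].
by rewrite (anti v w) // addNr.
Qed.

Fact cube_dif_act v c : cube_dif (x v *: c) = x v *: cube_dif c.
Proof. exact: linearZ. Qed.

Fact scale_actC (V : lmodType R) u v (c : V) : x u *: (x v *: c) = x v *: (x u *: c).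
Proof. by rewrite !scalerA mulrC. Qed.

Definition cube_dgm : dgm 'I_N :=
  @Dgm _ cube cube_dif (fun v => *:%R (x v)) cube_dif_dif cube_dif_act (@scale_actC cube).

Definition module_dgm : dgm 'I_N :=
  @Dgm _ M \0 (fun v => *:%R (x v)) (fun=> erefl) (fun v _ => esym (scaler0 _ _)) (@scale_actC M).

Definition zerop (C : zmodType) (_ : G) (c : C) : Prop := c = 0.

Definition cubep (g : G) (c : cube_dgm) : Prop := forall s, vcomp s g (c s).

(* Cochains supported on the vertices meeting [T]. *)
Definition cubez (T : {set 'I_N}) (g : G) (c : cube_dgm) : Prop :=
  cubep g c /\ forall s : {set 'I_N}, (forall v, v \in T -> v \notin s) -> c s = 0.

Lemma cubez0 g c : cubez finset.set0 g c <-> c = 0.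
Proof.
split=> [[_ c0]|->]; last by split=> // s; exact: vcomp0.
by apply: functional_extensionality_dep => s; apply: c0 => v; rewrite inE.
Qed.

Lemma module_gsub : gsub dx (fun g (m : module_dgm) => hcomp g m).
Proof.
split=> [g|g m m'|g m _|g v m]; first exact: (hcomp0 M_graded).
- exact: (hcompB M_graded).
- exact: (hcomp0 M_graded).
- exact: hcomp_var.
Qed.

Lemma zerop_gsub (C : dgm 'I_N) : gsub dx (@zerop C).
Proof.
split=> [g|g c c' -> ->|g c ->|g v c ->] //; rewrite /zerop ?subr0 ?raddf0 //.
Qed.

Lemma vcomp_var s g v (q : V s) : vcomp s g q -> vcomp s (g + dx v) (x v *: q).
Proof. by apply: vcompZ => h m; exact: hcomp_var. Qed.

Lemma cubep_gsub : gsub dx cubep.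
Proof.
split=> [g s|g c c' hc hc' s|g c hc t|g v c hc s]; first exact: vcomp0.
- exact: vcompB.
- apply: vcomp_sum => v vt; apply: vcomp_sign; apply: vcomp_kap => //.
  exact: subD1set.
- exact: vcomp_var.
Qed.

Lemma cubez_gsub T : gsub dx (cubez T).
Proof.
split=> [g|g c c' [hc zc] [hc' zc']|g c [hc zc]|g v c [hc zc]].
- by split=> // s; exact: vcomp0.
- split=> [|s sT]; first exact: (gsubB cubep_gsub).
  by change (c s - c' s = 0); rewrite zc // zc' // subrr.
- split=> [|t tT]; first exact: (gsub_dif cubep_gsub).
  rewrite /= /cube_dif big1 // => v vt; rewrite zc ?kap0 ?subD1set ?scaler0 //.
  by move=> u uT; rewrite !inE negb_and tT ?orbT.
- split=> [|s sT]; first exact: (gsub_act cubep_gsub).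
  by change (x v *: c s = 0); rewrite zc // scaler0.
Qed.

(** * Torsion of the Cech homology *)

Lemma cube_actn n v (c : cube_dgm) : actn n v c = x v ^+ n *: (c : cube).
Proof. by elim: n => [|n /= ->]; rewrite ?scale1r // exprS scalerA. Qed.

(** [V (v |: s)] is the localization of [V s] at [x v]. The claim covers every large exponent, so
    that one exponent can serve all [s]. *)
Lemma kap_lift (s : {set 'I_N}) v g (q : V (v |: s)) : v \notin s -> vcomp (v |: s) g q ->
  exists a, forall n, (a <= n)%N ->
  exists2 p : V s, vcomp s (g + dx v *+ n) p & kap (v |: s) p = x v ^+ n *: q.
Proof.
move=> vs [m [a [hm ->]]]; exists a => n an.
have E : (v |: s) :\: s = [set v]%SET.
  apply/finset.setP => u; rewrite !inE; case: eqVneq => [->|_] /=; first by rewrite vs.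
  by rewrite andNb.
exists (mkfrac (xp s) (x v ^+ (n - a) *: m) a).
  exists (x v ^+ (n - a) *: m), a; split=> //.
  have -> : g + dx v *+ n + face_deg s *+ a =
            g + face_deg (v |: s) *+ a + face_deg [set v]%SET *+ (n - a).
    rewrite (@face_degD s (v |: s)) ?finset.subsetUr // E /face_deg big_set1.
    by rewrite mulrnDl -!addrA -mulrnDr subnKC // [X in g + X = _]addrC.
  by have := @hcomp_xprodX _ [set v]%SET (n - a) _ hm; rewrite /xprod big_set1.
rewrite kapE ?finset.subsetUr // E /xprod big_set1 scalerA -exprD subnKC //.
by rewrite mkfracZ.
Qed.

Lemma kap_ker (s : {set 'I_N}) v (p : V s) : v \notin s -> kap (v |: s) p = 0 ->
  exists a, forall n, (a <= n)%N -> x v ^+ n *: p = 0.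
Proof.
move=> vs; rewrite -[p]loc_reprK; move: (repr p) => [m a] /=.
rewrite kapE ?finset.subsetUr // => /mkfrac_eq0[c].
have -> : (v |: s) :\: s = [set v]%SET.
  apply/finset.setP => u; rewrite !inE; case: eqVneq => [->|_] /=; first by rewrite vs.
  by rewrite andNb.
rewrite /xprod big_set1 big_setU1 //= exprMn scalerA -mulrA.
rewrite [_ ^+ c * x v ^+ a]mulrC mulrA -exprD => e.
exists (c + a)%N => n can; rewrite mkfracZ; apply/mkfrac_eq0; exists c.
rewrite scalerA mulrC -(subnK can) exprD -mulrA -scalerA.
by rewrite e scaler0.
Qed.

Lemma uniform_large (T : finType) (P : T -> nat -> Prop) :
  (forall t, exists a, forall n, (a <= n)%N -> P t n) -> exists n, forall t, P t n.
Proof.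
move=> H; have [a aP] := choice H; exists (\max_t a t) => t.
by apply: aP; exact: leq_bigmax.
Qed.

(** Up to signs, the Cech complex is the fiber of the map that localizes at [x v] the complex of
    faces avoiding [v]; inverting [x v] therefore kills its homology. There are finitely many faces,
    so a single exponent clears all denominators. *)
Lemma cube_torsion v : torsion dx v cubep (cubez finset.set0).
Proof.
move=> g c hc /cubez0 dc.
have [n nP] : exists n, forall s : {set 'I_N}, exists p : V s,
    [/\ vcomp s (g + dx v *+ n) p, v \in s -> p = 0 &
     v \notin s -> kap (v |: s) p =
       (-1) ^+ cech_pos s (v |: s) *: (x v ^+ n *: c (v |: s))].
  apply: uniform_large => s; have [vs|vs] := boolP (v \in s).
    by exists 0 => n _; exists 0; split=> //; exact: vcomp0.
  have [a aP] := kap_lift vs (hc (v |: s)); exists a => n /aP[p hp kp].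
  exists ((-1) ^+ cech_pos s (v |: s) *: p); split=> // [|_]; first exact: vcomp_sign.
  by rewrite kapZ ?finset.subsetUr // kp.
have {nP} [w wP] : exists w : cube, forall s : {set 'I_N},
    [/\ vcomp s (g + dx v *+ n) (w s), v \in s -> w s = 0 &
     v \notin s -> kap (v |: s) (w s) =
       (-1) ^+ cech_pos s (v |: s) *: (x v ^+ n *: c (v |: s))].
  by exists (fun s => projT1 (cid (nP s))) => s; exact: (projT2 (cid (nP s))).
(* This difference vanishes on the faces [s] containing [v]: there the boundary of [w] has only the
   term at [s :\ v], chosen to match [c]. *)
pose c2 : cube := x v ^+ n *: (c : cube) - cube_dif w.
have c2v (s : {set 'I_N}) : v \in s -> c2 s = 0.
  move=> vs; change (x v ^+ n *: c s - cube_dif w s = 0).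
  have -> : cube_dif w s = (-1) ^+ cech_pos (s :\ v) s *: kap s (w (s :\ v)).
    rewrite /cube_dif (bigD1 v) //= big1 ?addr0 // => u /andP[us uv].
    have [_ w0 _] := wP (s :\ u); rewrite [w _]w0 ?kap0 ?subD1set ?scaler0 //.
    by rewrite !inE eq_sym uv.
  have [_ _] := wP (s :\ v); rewrite finset.setD1K // => ->; last by rewrite !inE eqxx.
  by rewrite scalerA -expr2 sqrr_sign scale1r subrr.
have dc2 : cube_dif c2 = 0.
  rewrite /c2 linearB linearZ /= cube_dif_dif subr0.
  by change (x v ^+ n *: dif cube_dgm c = 0); rewrite dc scaler0.
(* At [v |: s] the cycle condition for [c2] reduces to the image of [c2 s] under localization at
   [x v], which is therefore zero. *)
have [m mP] : exists m, forall s, x v ^+ m *: c2 s = 0.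
  apply: uniform_large => s; have [vs|vs] := boolP (v \in s).
    by exists 0 => n' _; rewrite c2v // scaler0.
  apply: (kap_ker vs).
  have : cube_dif c2 (v |: s) = 0 by rewrite dc2.
  rewrite /cube_dif (bigD1 v) ?finset.setU11 //= big1 ?addr0; last first.
    move=> u /andP[_ uv]; rewrite c2v ?kap0 ?subD1set ?scaler0 //.
    by rewrite !inE eq_sym uv eqxx.
  rewrite finset.setU1K // => /(congr1 ( *:%R ((-1) ^+ cech_pos s (v |: s)))).
  by rewrite scalerA -expr2 sqrr_sign scale1r scaler0.
exists (m + n)%N, (x v ^+ m *: w); split.
  move=> s; rewrite mulrnDr [_ *+ m + _]addrC addrA.
  change (vcomp s (g + dx v *+ n + dx v *+ m) (x v ^+ m *: w s)).
  apply: vcompZ; last by have [] := wP s.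
  by move=> h y hy; have := @hcomp_xprodX _ [set v]%SET m _ hy;
    rewrite /xprod /face_deg !big_set1.
apply/cubez0; rewrite cube_actn exprD -scalerA.
have -> : dif cube_dgm (x v ^+ m *: w) = x v ^+ m *: cube_dif w by exact: linearZ.
by rewrite -scalerBr; apply: functional_extensionality_dep => s; exact: mP.
Qed.

(** * The filtration by variables and the projection onto [M] *)

Lemma vertex_act_inj (s : {set 'I_N}) v (q : V s) : v \in s -> x v *: q = 0 -> q = 0.
Proof.
move=> vs; rewrite -[q]loc_reprK; move: (repr q) => [m a] /=.
rewrite mkfracZ => /mkfrac_eq0[c e]; apply/mkfrac_eq0; exists c.+1.
rewrite exprSr -scalerA {2}/xprod (bigD1 v) //= mulrC -!scalerA.
by rewrite scalerA mulrC -scalerA e scaler0.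
Qed.

Lemma vertex_act_surj (s : {set 'I_N}) v g (q : V s) : v \in s -> vcomp s (g + dx v) q ->
  exists2 p, vcomp s g p & x v *: p = q.
Proof.
(* The inverse of [x v] on [V s] is [xp (s :\ v) / xp s]. *)
move=> vs [m [a [hm ->]]]; exists (mkfrac (xp s) (xp (s :\ v) *: m) a.+1).
  exists (xp (s :\ v) *: m), a.+1; split=> //.
  have -> : g + face_deg s *+ a.+1 = g + dx v + face_deg s *+ a + face_deg (s :\ v).
    rewrite mulrSr addrA {2}/face_deg (big_setD1 v) //= addrA.
    by congr (_ + _); rewrite addrAC.
  exact: hcomp_xprod.
rewrite mkfracZ [RHS](mkfrac_expand _ _ _ 1) expr1 add1n scalerA.
by congr (mkfrac _ (_ *: _) _); rewrite [RHS]/xprod (big_setD1 v).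
Qed.

(** Only the faces containing [v] and disjoint from [T] survive in the quotient, and there [x v]
    divides the inverted element [xp s]. *)
Lemma cube_act_bij T v : act_bij dx v (cubez (v |: T)) (cubez T).
Proof.
have vdisj (s : {set 'I_N}) : v \notin s -> (forall u, u \in T -> u \notin s) ->
    forall u, u \in v |: T -> u \notin s.
  by move=> vs sT u; rewrite !inE => /orP[/eqP->|/sT].
split=> [g c [hc zc] [_ zxc]|g y [hy zy]].
  split=> // s sT; have [vs|vs] := boolP (v \in s); last by apply: zc; exact: vdisj.
  by apply: (vertex_act_inj vs); exact: (zxc s sT).
have cP (s : {set 'I_N}) : exists p : V s, [/\ vcomp s g p,
    v \in s -> x v *: p = y s & v \notin s -> p = 0].
  have [vs|vs] := boolP (v \in s); last by exists 0; split=> //; exact: vcomp0.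
  by have [p hp xpy] := vertex_act_surj vs (hy s); exists p.
have {cP} [c cP] : exists c : cube, forall s : {set 'I_N}, [/\ vcomp s g (c s),
    v \in s -> x v *: c s = y s & v \notin s -> c s = 0].
  by exists (fun s => projT1 (cid (cP s))) => s; exact: (projT2 (cid (cP s))).
have hc : cubep g c by move=> s; have [] := cP s.
exists c.
  split=> // s sT; have [_ _] := cP s; apply.
  by apply: sT; rewrite !inE eqxx.
split=> [|s sT]; first by apply: (gsubB cubep_gsub) => //; exact: (gsub_act cubep_gsub).
change (y s - x v *: c s = 0).
have [_ c1 c0] := cP s; have [vs|vs] := boolP (v \in s); first by rewrite [x v *: _]c1 ?subrr.
by rewrite [c s]c0 // scaler0 zy ?subrr //; exact: vdisj.
Qed.

Lemma cubez_incl (T T' : {set 'I_N}) : T \subset T' -> incl (cubez T) (cubez T').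
Proof.
move=> TT' g c [hc zc]; split=> // s sT'; apply: zc => v vT.
by apply: sT'; exact: (fintype.subsetP TT').
Qed.

(** Adding the variables of [l'] one at a time, each step discards a subquotient on which the added
    variable is bijective; that variable belongs to [l], so the Koszul complex is acyclic there. *)
Lemma kos_cubez (l l' : seq 'I_N) g : {subset l' <= l} ->
  acyc (@kosp _ _ dx l cube_dgm cubep) (@kosp _ _ dx l cube_dgm (cubez finset.set0)) g <->
  acyc (@kosp _ _ dx l cube_dgm cubep)
    (@kosp _ _ dx l cube_dgm (cubez [set v in l']%SET)) g.
Proof.
elim: l' => [|v l' IHl] l'l; first by rewrite finset.set_nil.
rewrite IHl; last by move=> u ul; apply: l'l; rewrite inE ul orbT.
rewrite finset.set_cons; apply: kos_acyc_quot; rewrite ?finset.subsetUr //.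
- exact: cubep_gsub.
- exact: cubez_gsub.
- exact: cubez_gsub.
- by apply: cubez_incl; exact: finset.subsetUr.
- by move=> h c [].
- move=> h; apply: (kos_act_bij (v := v)); try exact: cubez_gsub.
    exact: cube_act_bij.
  by apply: l'l; rewrite mem_head.
Qed.

(** A section of the projection onto the component of the empty face, which is [M] localized at [1].
    It is a chain map only modulo the cochains that vanish on the empty face. *)
Definition vertex0 (m : M) : cube := fun s =>
  if s == finset.set0 then mkfrac (xp s) m 0 else 0.

Fact vertex0_sub : zmod_morphism vertex0.
Proof.
move=> m m'; apply: functional_extensionality_dep => s.
change (vertex0 (m - m') s = vertex0 m s - vertex0 m' s).
rewrite /vertex0; case: ifP => _; last by rewrite subr0.
by rewrite -[- mkfrac _ _ _]scaleN1r mkfracZ mkfracDl scaleN1r.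
Qed.
HB.instance Definition _ :=
  GRing.isZmodMorphism.Build module_dgm cube_dgm vertex0 vertex0_sub.

Lemma vertex0_qiso : qiso dx (vertex0 : {additive module_dgm -> cube_dgm}) 0
  (fun g (m : module_dgm) => hcomp g m) (@zerop module_dgm)
  cubep (cubez finset.setT).
Proof.
have disj0 (s : {set 'I_N}) : (forall v, v \in [set: 'I_N]%SET -> v \notin s) -> s = finset.set0.
  by move=> sT; apply/finset.setP => v; rewrite inE; apply/negbTE/sT; rewrite inE.
have hom g (m : M) : hcomp g m -> cubep g (vertex0 m).
  move=> hm s; rewrite /vertex0; case: ifP => [/eqP ->|_]; last exact: vcomp0.
  by exists m, 0; rewrite addr0.
have xp0 : xp finset.set0 = 1 by rewrite /xprod big_set0.
split=> [g m hm|g m hm|g c hc|g m hm|g v m hm]; rewrite ?addr0.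
- exact: hom.
- split=> [[_ /(_ finset.set0)]|->]; last first.
    by rewrite raddf0; exact: (gsub0 (cubez_gsub _)).
  move=> h; have /mkfrac_eq0[c] : mkfrac (xp finset.set0) m 0 = 0.
    have : vertex0 m finset.set0 = 0 by apply: h => v _; rewrite inE.
    by rewrite /vertex0 eqxx.
  by rewrite xp0 expr1n scale1r.
- rewrite addr0 in hc; have [m [a [hm cE]]] := hc finset.set0.
  rewrite /face_deg big_set0 mul0rn addr0 in hm.
  exists m => //; split=> [|s /disj0 ->]; first by apply: (gsubB cubep_gsub) => //; exact: hom.
  change (c finset.set0 - vertex0 m finset.set0 = 0).
  rewrite /vertex0 eqxx cE [mkfrac _ m 0](mkfrac_expand _ _ _ a).
  by rewrite xp0 expr1n scale1r addn0 subrr.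
- split=> [|s /disj0 ->].
    by rewrite raddf0 sub0r; apply: (gsubN cubep_gsub); apply: (gsub_dif cubep_gsub); exact: hom.
  rewrite raddf0 sub0r; change (- cube_dif (vertex0 m) finset.set0 = 0).
  by rewrite /cube_dif big_set0 oppr0.
- have -> : vertex0 (act module_dgm v m) - act cube_dgm v (vertex0 m) = 0; last first.
    exact: (gsub0 (cubez_gsub _)).
  apply: functional_extensionality_dep => s.
  change (vertex0 (x v *: m) s - x v *: vertex0 m s = 0).
  by rewrite /vertex0; case: ifP; rewrite ?mkfracZ ?scaler0 subrr.
Qed.

Lemma cube_kos (U : G -> Prop) : (forall g v, U g -> U (g + dx v)) ->
  let l := enum 'I_N in
  (forall g, U g -> acyc cubep (cubez finset.set0) g) <->
  (forall g, U g -> acyc (@kosp _ _ dx l module_dgm (fun g m => hcomp g m))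
                         (@kosp _ _ dx l module_dgm (@zerop module_dgm)) g).
Proof.
move=> UU l; rewrite (@kos_torsion _ _ dx U l cube_dgm) //; last exact: cube_torsion.
- have E g := @kos_qiso _ _ dx l _ _ _ 0 _ _ _ _ g module_gsub (zerop_gsub _)
    cubep_gsub (cubez_gsub _) vertex0_qiso.
  have lT : finset.setT = [set v in l]%SET.
    by apply/finset.setP => v; rewrite !inE mem_enum.
  split=> aU g Ug.
    by rewrite E addr0 lT; apply/kos_cubez => //; exact: aU.
  by apply/(@kos_cubez l l) => //; rewrite -lT -[g]addr0 -E; exact: aU.
- exact: cubep_gsub.
- exact: cubez_gsub.
Qed.

(** * From the cube back to Cech cohomology *)

Definition cube_res p (c : cube) : cech x dx M p := fun s => c (val s).
Arguments cube_res : clear implicits.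

Lemma cube_dif_cech p (c : cube) (t : face N p.+1) :
  cube_dif c (val t) = cech_fun (cube_res p c) t.
Proof.
pose F s : V (val t) := (-1) ^+ cech_pos s (val t) *: kap (val t) (c s).
have -> : cech_fun (cube_res p c) t = \sum_(s : face N p | val s \subset val t) F (val s) by [].
have -> : cube_dif c (val t) = \sum_(v in val t) F (val t :\ v) by [].
transitivity (\sum_(s : {set 'I_N} | (#|s| == p) && (s \subset val t)) F s).
  have inj : {in val t &, injective (fun v => val t :\ v)}.
    move=> v w vt wt /finset.setP/(_ v); rewrite !inE eqxx vt andbT /=.
    by case: eqP.
  rewrite -(big_imset F inj); apply: eq_bigl => s; apply/imsetP/idP => [[v vt ->]|].
    rewrite subD1set andbT -eqSS; move: (valP t).
    by rewrite (cardsD1 v) vt.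
  move=> /andP[/eqP sp st].
  have /cards1P[v tsv] : #|val t :\: s| == 1.
    by rewrite cardsD (finset.setIidPr st) sp (eqP (valP t)) subSnn.
  have /finset.setP/(_ v) := tsv; rewrite !inE eqxx => /andP[vs vt].
  exists v => //; rewrite -tsv finset.setDDr finset.setDv finset.set0U.
  exact/esym/finset.setIidPr.
rewrite (reindex_omap (val : face N p -> {set 'I_N}) insub); last first.
  by move=> s /andP[sp _]; rewrite insubT.
by apply: eq_bigl => s; rewrite valK eqxx (valP s) andbT.
Qed.

Lemma cube_dif_eq0 (c : cube) : cube_dif c = 0 <-> forall p, cech_d x dx M p (cube_res p c) = 0.
Proof.
split=> [dc p|dc]; apply: functional_extensionality_dep => t.
  by change (cech_fun (cube_res p c) t = 0); rewrite -cube_dif_cech dc.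
change (cube_dif c t = 0); case E: #|t| => [|p].
  by rewrite /cube_dif; move/eqP: E; rewrite cards_eq0 => /eqP ->; rewrite big_set0.
have tp : #|t| == p.+1 by rewrite E.
rewrite (@cube_dif_cech p c (exist _ t tp)).
by change (cech_d x dx M p (cube_res p c) (exist _ t tp) = 0); rewrite dc.
Qed.

Definition cube_glue (X : forall p, cech x dx M p) : cube :=
  fun s => X #|s| (exist _ s (eqxx _)).

Lemma cube_glueK X p : cube_res p (cube_glue X) = X p.
Proof.
apply: functional_extensionality_dep => -[s sp].
rewrite /cube_res /cube_glue /=; move: (sp); rewrite -(eqP sp) => sp'.
by rewrite (bool_irrelevance sp' (eqxx _)).
Qed.

(** Matching on [idP] provides the proof of cardinality that a face carries. *)
Definition cube_ext p (y : cech x dx M p) : cube := fun s =>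
  if @idP (#|s| == p) is ReflectT sp then y (exist _ s sp) else 0.

Lemma cube_extK p (y : cech x dx M p) : cube_res p (cube_ext y) = y.
Proof.
apply: functional_extensionality_dep => -[s sp]; rewrite /cube_res /cube_ext /=.
by case: {-}_ / idP => [sp'|] //; rewrite (bool_irrelevance sp' sp).
Qed.

Lemma cube_ext0 p q (y : cech x dx M p) : q != p -> cube_res q (cube_ext y) = 0.
Proof.
move=> qp; apply: functional_extensionality_dep => -[s sq].
change (cube_ext y s = 0); rewrite /cube_ext.
by case: {-}_ / idP => [sp|] //; case/eqP: qp; rewrite -(eqP sq) (eqP sp).
Qed.

Lemma cube_sumE (J : Type) (r : seq J) (F : J -> cube) s :
  (\sum_(j <- r) F j) s = \sum_(j <- r) F j s.
Proof. by elim/big_rec2: _ => // j c d _ <-. Qed.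

Lemma mkfrac_sum (W : lmodType R) (f : R) (J : Type) (r : seq J) (m : J -> W) a :
  mkfrac f (\sum_(j <- r) m j) a = \sum_(j <- r) mkfrac f (m j) a.
Proof.
elim/big_rec2: _ => [|j m' d _ <-]; first exact: mkfrac0.
by rewrite mkfracDl.
Qed.

(** There are finitely many faces, and each component is a fraction whose numerator splits into
    homogeneous parts. *)
Lemma cube_span (b : cube) : exists l : seq (G * cube),
  (forall u, u \in l -> cubep u.1 u.2) /\ b = \sum_(u <- l) u.2.
Proof.
have /choice[L LP] : forall s, exists l : seq (G * cube),
    (forall u, u \in l -> cubep u.1 u.2) /\
    (fun t => if t == s then b t else 0 : V t) = \sum_(u <- l) u.2 :> cube.
  move=> s; set m := (repr (b s)).1; set a := (repr (b s)).2.
  have [r [c [hc mE]]] := hcomp_span M_graded m.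
  pose w h : cube := fun t => if t == s then mkfrac (xp t) (c h) a else 0.
  exists [seq (h - face_deg s *+ a, w h) | h <- r]; split.
    move=> u /mapP[h _ ->] t /=; rewrite /w; case: eqP => [->|_]; last exact: vcomp0.
    by exists (c h), a; rewrite subrK.
  apply: functional_extensionality_dep => t; rewrite big_map cube_sumE /w /=.
  case: eqP => [->|_]; last by rewrite big1.
  by rewrite -mkfrac_sum -mE /m /a loc_reprK.
exists (flatten [seq L s | s <- enum {set 'I_N}]); split.
  by move=> u /flattenP[_ /mapP[s _ ->]]; have [+ _] := LP s; apply.
rewrite big_flatten big_map big_enum /=.
rewrite (eq_bigr (fun s => (fun t => if t == s then b t else 0 : V t) : cube)); last first.
  by move=> s _; have [_ ->] := LP s.
apply: functional_extensionality_dep => t; rewrite cube_sumE.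
by rewrite (bigD1 t) //= eqxx big1 ?addr0 // => s /negbTE; rewrite eq_sym => ->.
Qed.

(** A common denominator and one more power of [xp s] reduce the claim to the directness of the
    grading of [M]. *)
Lemma vcomp_free s (r : seq G) (w : G -> V s) : uniq r ->
  (forall h, vcomp s h (w h)) -> \sum_(h <- r) w h = 0 ->
  forall h, h \in r -> w h = 0.
Proof.
move=> ur hw; have /choice[m mP] := hw; have {mP}/choice[a aP] := mP.
pose A := \sum_(h <- r) a h.
pose m' h := xp s ^+ (A - a h) *: m h.
have aA h : h \in r -> (a h <= A)%N.
  by move=> hr; rewrite /A (big_rem h hr) leq_addr.
have wE h : h \in r -> w h = mkfrac (xp s) (m' h) A.
  move=> hr; have [_ ->] := aP h.
  by rewrite (mkfrac_expand _ _ _ (A - a h)) subnK ?aA.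
rewrite (eq_big_seq _ wE) -mkfrac_sum => /mkfrac_eq0[c].
rewrite scaler_sumr => e h hr; rewrite wE //; apply/mkfrac_eq0; exists c.
(* [e0] is the degree of [xp s ^+ (A + c)], by which all numerators are shifted; [m2] is zero
   outside the shifted list. *)
pose e0 := face_deg s *+ (A + c).
pose m2 g := if g - e0 \in r then xp s ^+ c *: m' (g - e0) else 0.
have := hcomp_free M_graded (s := [seq h + e0 | h <- r]) (c := m2).
rewrite (map_inj_uniq (addIr e0)) => /(_ ur) H.
have : m2 (h + e0) = 0.
  apply: H; last exact: map_f.
    move=> g; rewrite /m2; case: ifP => [gr|_]; last exact: (hcomp0 M_graded).
    have [hm _] := aP (g - e0).
    rewrite /m' scalerA -exprD; have := hcomp_xprodX s (c + (A - a (g - e0))) hm.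
    congr hcomp; rewrite -addrA -mulrnDr addnCA subnKC ?aA // addnC.
    by rewrite -/e0 subrK.
  rewrite big_map -[RHS]e; apply: eq_big_seq => g gr.
  by rewrite /m2 addrK gr.
by rewrite /m2 addrK hr.
Qed.

Lemma cubep_ext p g (y : cech x dx M p) : hcomp g y -> cubep g (cube_ext y).
Proof.
move=> hy s; rewrite /cube_ext; case: {-}_ / idP => [sp|_]; last exact: vcomp0.
exact: (hy (exist _ s sp)).
Qed.

Lemma cube_ext_cycle p (y : cech x dx M p) : cech_d x dx M p y = 0 ->
  cube_dif (cube_ext y) = 0.
Proof.
move=> dy; apply/cube_dif_eq0 => q; have [->|qp] := eqVneq q p.
  by rewrite cube_extK.
by rewrite cube_ext0 // raddf0.
Qed.

(** From left to right a cocycle is extended by zero. From right to left the primitives found for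
    the separate sizes are glued, then replaced by their degree [g] component, since vanishing
    cohomology gives no homogeneous primitive. *)
Lemma cube_acycP g : acyc cubep (cubez finset.set0) g <->
  forall i, ~ Supp (cech_cohomology x dx M i) g.
Proof.
split=> [aA [|i] /homology_SuppP[y [hy dy ny]]|nS].
- have [||b _ /cubez0 hb] := aA (cube_ext y); first exact: cubep_ext.
    exact/cubez0/cube_ext_cycle.
  apply: (ny 0); rewrite -(cube_extK y).
  have /eqP := hb; rewrite subr_eq0 => /eqP ->.
  apply: functional_extensionality_dep => -[s s0].
  change (0 = cube_dif b s); rewrite /cube_dif.
  by move: s0; rewrite cards_eq0 => /eqP ->; rewrite big_set0.
- have [||b _ /cubez0 hb] := aA (cube_ext y); first exact: cubep_ext.
    exact/cubez0/cube_ext_cycle.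
  apply: (ny (cube_res i b)); rewrite -(cube_extK y).
  have /eqP := hb; rewrite subr_eq0 => /eqP ->.
  apply: functional_extensionality_dep => t.
  by change (cech_fun (cube_res i b) t = cube_dif b (val t)); rewrite cube_dif_cech.
move=> c hc /cubez0 dc; have /cube_dif_eq0 dcp := dc.
(* Only zero is a boundary among cochains of size 0, so the vanishing of the zeroth cohomology
   forces this component to be zero. *)
have c0 : c finset.set0 = 0.
  have s0 : #|@finset.set0 'I_N| == 0 by rewrite cards0.
  apply: contrapT => nc0; apply: (nS 0); apply/homology_SuppP.
  exists (cube_res 0 c); split=> // [s|y e]; first exact: hc.
  by apply: nc0; rewrite -[LHS]/(cube_res 0 c (exist _ finset.set0 s0)) -e.
have ex p : exists y, cech_d x dx M p y = cube_res p.+1 c.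
  apply: contrapT => nX; apply: (nS p.+1); apply/homology_SuppP.
  exists (cube_res p.+1 c); split=> // [s|y e]; first exact: hc.
  by apply: nX; exists y.
have {ex} [X XP] : exists X : forall p, cech x dx M p,
    forall p, cech_d x dx M p (X p) = cube_res p.+1 c.
  by exists (fun p => projT1 (cid (ex p))) => p; exact: (projT2 (cid (ex p))).
have cE : c = cube_dif (cube_glue X).
  apply: functional_extensionality_dep => s; case E: #|s| => [|p].
    by move/eqP: E; rewrite cards_eq0 => /eqP ->; rewrite c0 /cube_dif big_set0.
  have sp : #|s| == p.+1 by rewrite E.
  rewrite (@cube_dif_cech p _ (exist _ s sp)) cube_glueK.
  by change (c s = cech_d x dx M p (X p) (exist _ s sp)); rewrite XP.
have [l [hl lE]] := cube_span (cube_glue X).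
have [] := @homogeneous_preimage _ cube cube cubep cubep (fun c => c = 0) cube_dif
  _ _ _ _ _ _ g c l hc hl.
- by move=> h s; exact: vcomp0.
- by move=> h b b'; exact: (gsubD cubep_gsub).
- by move=> h s; exact: vcomp0.
- by move=> h b b'; exact: (gsubB cubep_gsub).
- by move=> h b; exact: (gsub_dif cubep_gsub).
- move=> r w ur hw e h hr; apply: functional_extensionality_dep => s.
  apply: (@vcomp_free s r (fun h => w h s)) => // [h'|]; first exact: hw.
  by rewrite -cube_sumE e.
- by rewrite -lE; change (c - cube_dif (cube_glue X) = 0); rewrite -cE subrr.
by move=> b hb e; exists b => //; apply/cubez0.
Qed.

End CechCube.

(** * Free resolutions and Tor *)

Section GradedFree.
Variables (R : comNzRingType) (G : zmodType) (RG : G -> classical_sets.set R).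
Hypothesis RG0 : forall g, RG g 0.
Hypothesis RGB : forall g a b, RG g a -> RG g b -> RG g (a - b).
Hypothesis RGM : forall g h a b, RG g a -> RG h b -> RG (g + h) (a * b).
Hypothesis RG1 : RG 0 1.

Local Notation gmod := (gmod R G).
Local Notation garrow := (garrow R G).

Record weakly_graded (A : gmod) : Prop := WeaklyGraded {
  wgr0 : forall g, hcomp g (0 : A);
  wgrB : forall g (x y : A), hcomp g x -> hcomp g y -> hcomp g (x - y);
  wgrZ : forall g h a (x : A), RG g a -> hcomp h x -> hcomp (g + h) (a *: x)
}.

Lemma wgrD (A : gmod) g (x y : A) : weakly_graded A ->
  hcomp g x -> hcomp g y -> hcomp g (x + y).
Proof.
by move=> wA hx hy; rewrite -[y]opprK -[- y]sub0r; do ?apply: (wgrB wA) => //; exact: (wgr0 wA).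
Qed.

Lemma wgr_sum (A : gmod) g (J : eqType) (r : seq J) (F : J -> A) :
  weakly_graded A -> (forall j, j \in r -> hcomp g (F j)) -> hcomp g (\sum_(j <- r) F j).
Proof.
move=> wA hF; rewrite big_seq; apply: (big_ind (hcomp g)) => [|x y|//]; first exact: (wgr0 wA).
by move=> hx hy; exact: wgrD.
Qed.

(* A free module on homogeneous generators [gvec b] of degree [gdeg b]. *)
Record gfree (A : gmod) : Type := GFree {
  gbasis : choiceType;
  gdeg : gbasis -> G;
  gvec : gbasis -> A;
  gcf : gbasis -> A -> R;
  gcfP : forall b a x y, gcf b (a *: x + y) = a * gcf b x + gcf b y;
  gcf_vec : forall b b', gcf b (gvec b') = (b' == b)%:R;
  gcf_hom : forall g x, hcomp g x <-> forall b, RG (g - gdeg b) (gcf b x);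
  gcf_sum : forall x, exists s : seq gbasis, x = \sum_(b <- s) gcf b x *: gvec b;
  gcf_map : forall (f : R -> R) x, f 0 = 0 -> exists y, forall b, gcf b y = f (gcf b x)
}.

Arguments gbasis {A} f : rename.
Arguments gdeg {A} f b : rename.
Arguments gvec {A} f b : rename.
Arguments gcf {A} f b x : rename.
Arguments gcfP {A} f b a x y : rename.
Arguments gcf_vec {A} f b b' : rename.
Arguments gcf_hom {A} f g x : rename.
Arguments gcf_sum {A} f x : rename.
Arguments gcf_map {A} f h x _ : rename.

Section GfreeTheory.
Variables (A : gmod) (fA : gfree A).

Lemma gcf0 b : gcf fA b 0 = 0.
Proof.
apply: (addrI (gcf fA b 0)).
by have := gcfP fA b 1 0 0; rewrite scaler0 !addr0 mul1r => <-.
Qed.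

Lemma gcfD b x y : gcf fA b (x + y) = gcf fA b x + gcf fA b y.
Proof. by have := gcfP fA b 1 x y; rewrite scale1r mul1r. Qed.

Lemma gcfZ b a x : gcf fA b (a *: x) = a * gcf fA b x.
Proof. by have := gcfP fA b a x 0; rewrite gcf0 !addr0. Qed.

Lemma gcfB b x y : gcf fA b (x - y) = gcf fA b x - gcf fA b y.
Proof. by rewrite gcfD -scaleN1r gcfZ mulN1r. Qed.

Lemma gcf_bigsum b (J : Type) (r : seq J) (F : J -> A) :
  gcf fA b (\sum_(j <- r) F j) = \sum_(j <- r) gcf fA b (F j).
Proof. by apply: (big_morph (gcf fA b)) => [x y|]; [exact: gcfD | exact: gcf0]. Qed.

Lemma gfree_wgr : weakly_graded A.
Proof.
split=> [g|g x y /(gcf_hom fA) hx /(gcf_hom fA) hy|g h a x ha /(gcf_hom fA) hx];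
  apply/(gcf_hom fA) => b.
- by rewrite gcf0.
- by rewrite gcfB; exact: RGB.
- by rewrite gcfZ -addrA; exact: RGM.
Qed.
End GfreeTheory.

(* The next notions are predicates on linear maps so that comparing the
   differentials of [fres] with [hker_cover] does not unfold the modules. *)
Definition homogeneous_map (A B : gmod) (d : {linear A -> B}) : Prop :=
  forall g y, hcomp g y -> hcomp g (d y).

Definition homogeneously_exact (A B C : gmod) (d' : {linear A -> B})
    (d : {linear B -> C}) : Prop :=
  (forall y, d (d' y) = 0) /\
  forall g y, hcomp g y -> d y = 0 -> exists2 z, hcomp g z & d' z = y.

Section FreeCover.
Variable u : garrow.

Lemma hker_free_gfree : gfree (hker_free RG u).
Proof.
pose cf (K : hker u) (D : hker_free RG u) := coeff K D.
apply: (@GFree (hker_free RG u) (hker u) (fun K => (val K).1) (fun K => << K >>) cf).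
- by move=> K a D E; rewrite /cf coeffD coeffZ.
- by move=> K K'; rewrite /cf coeffU mul1r.
- by [].
- move=> D; exists (dom D); rewrite -[LHS]freeg_sumE; apply: eq_bigr => K _.
  by apply/eqP/freeg_eqP => K'; rewrite coeffZ !coeffU mul1r.
(* Applied coefficientwise, [f] keeps a finite support because [f 0 = 0]. *)
- move=> f D f0; exists (\sum_(K <- dom D) << f (coeff K D) *g K >>) => K.
  rewrite /cf raddf_sum /=; under eq_bigr do rewrite coeffU.
  have [KD|KD] := boolP (K \in dom D); last first.
    rewrite coeff_outdom // f0 big_seq big1 // => K' K'D.
    by case: eqP K'D KD => [->->|_]; rewrite ?mulr0.
  rewrite (bigD1_seq K) ?uniq_dom //= eqxx mulr1 big1 ?addr0 // => K' /negbTE ->.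
  by rewrite mulr0.
Qed.

Lemma hker_cover_hom : weakly_graded (gsrc u) ->
  homogeneous_map (hker_cover RG u : {linear hker_free RG u -> gsrc u}).
Proof.
move=> wu g D hD; rewrite /= free_liftE; apply: wgr_sum => // K _.
have /asboolP[hK _] := valP K; rewrite -[g](subrK (val K).1).
exact: (wgrZ wu).
Qed.

Lemma hker_cover_exact :
  homogeneously_exact (hker_cover RG u : {linear hker_free RG u -> gsrc u}) u.
Proof.
split=> [D|g x hx ux]; first exact: hker_cover_comp.
have xP : `[< hcomp (g, x).1 (g, x).2 /\ u (g, x).2 = 0 >] by apply/asboolP.
exists << exist _ (g, x) xP >>.
  move=> K; rewrite coeffU mul1r; case: eqP => [<-|_]; last exact: RG0.
  by rewrite subrr.
by rewrite /= /free_lift liftU scale1r.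
Qed.

End FreeCover.

Section FreeResolution.
Variable M : gmod.
Hypothesis M_graded : is_graded RG M.

Local Notation F := (fres_mod RG M).

Let fprev (j : nat) : garrow := iter j (hker_cover RG) (@GArrow _ _ M M \0).

Let fprev_wgr j : weakly_graded (gsrc (fprev j)).
Proof.
case: j => [|j]; last exact: (gfree_wgr (hker_free_gfree _)).
split; [exact: (hcomp0 M_graded) | exact: (hcompB M_graded) | exact: (hcompZ M_graded)].
Qed.

Lemma fres_gfree j : gfree (F j).
Proof. exact (hker_free_gfree (fprev j)). Qed.

(* Unification is very slow on the iterates defining [fres]. *)
Ltac abstract_iterate :=
  lazy beta iota zeta delta [fprev fres_d fres_mod fres iter];
  match goal with |- context[hker_cover RG (hker_cover RG ?u)] => generalize u end.

Lemma fres_d_hom j : homogeneous_map (fres_d RG M j).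
Proof.
abstract_iterate => u.
exact (@hker_cover_hom (hker_cover RG u) (gfree_wgr (hker_free_gfree u))).
Qed.

Lemma fres_d_exact j : homogeneously_exact (fres_d RG M j.+1) (fres_d RG M j).
Proof. abstract_iterate => u; exact (@hker_cover_exact (hker_cover RG u)). Qed.

Lemma fres_aug_hom : homogeneous_map (fres_aug RG M).
Proof. exact (@hker_cover_hom (fprev 0) (fprev_wgr 0)). Qed.

Lemma fres_aug_exact : homogeneously_exact (fres_d RG M 0) (fres_aug RG M).
Proof. exact (@hker_cover_exact (fprev 1)). Qed.

(** Exactness before the zero map is surjectivity, with homogeneous preimages. *)
Lemma fres_aug_surj : homogeneously_exact (fres_aug RG M) (\0 : {linear M -> M}).
Proof. exact (@hker_cover_exact (fprev 0)). Qed.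

End FreeResolution.
End GradedFree.

Arguments gbasis {R G RG A} f : rename.
Arguments gdeg {R G RG A} f b : rename.
Arguments gvec {R G RG A} f b : rename.
Arguments gcf {R G RG A} f b x : rename.
Arguments gcfP {R G RG A} f b a x y : rename.
Arguments gcf_vec {R G RG A} f b b' : rename.
Arguments gcf_hom {R G RG A} f g x : rename.
Arguments gcf_sum {R G RG A} f x : rename.
Arguments gcf_map {R G RG A} f h x _ : rename.

(** * Multigraded polynomials and division by a variable *)

Section Polynomials.
Variables (S : comNzRingType) (k : nat) (n : 'I_k -> nat).

Local Notation N := (\sum_(i < k) n i)%N.
Local Notation P := (mring S n).
Local Notation G := 'rV[int]_k.
Local Notation RG := (@mring_comp S k n).
Local Notation dx := (@vardeg k n).

Lemma mondegD (m m' : 'X_{1..N}) : mondeg (m + m')%MM = mondeg m + mondeg m'.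
Proof.
by rewrite /mondeg -big_split; apply: eq_bigr => v _; rewrite mnmDE mulrnDr.
Qed.

Lemma mondeg0 : mondeg (0 : 'X_{1..N})%MM = 0 :> G.
Proof. by rewrite /mondeg big1 // => v _; rewrite mnm0E. Qed.

Lemma mondegU v : mondeg U_(v)%MM = dx v :> G.
Proof.
rewrite /mondeg (bigD1 v) //= mnm1E eqxx big1 ?addr0 // => w /negbTE vw.
by rewrite mnm1E eq_sym vw.
Qed.

Lemma mring_compP g (p : P) : RG g p <-> forall m, p@_m != 0 -> mondeg m = g.
Proof. by split=> h m; have := h m; rewrite mcoeff_msupp. Qed.

Lemma mring_comp0 g : RG g 0.
Proof. by apply/mring_compP => m; rewrite mcoeff0 eqxx. Qed.

Lemma mring_compB g (p q : P) : RG g p -> RG g q -> RG g (p - q).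
Proof.
move=> /mring_compP hp /mring_compP hq; apply/mring_compP => m; rewrite mcoeffB.
have [p0|/hp //] := eqVneq p@_m 0; have [q0|/hq //] := eqVneq q@_m 0.
by rewrite p0 q0 subrr eqxx.
Qed.

Lemma mring_compM g h (p q : P) : RG g p -> RG h q -> RG (g + h) (p * q).
Proof.
move=> hp hq m /msuppM_le /allpairsP[[m1 m2] [/= /hp <- /hq <- ->]].
exact: mondegD.
Qed.

Lemma mring_comp_mon (m : 'X_{1..N}) (c : S) : RG (mondeg m) (c *: 'X_[m]).
Proof.
apply/mring_compP => m'; rewrite mcoeffZ mcoeffX.
by case: (eqVneq m m') => [->//|_]; rewrite mulr0 eqxx.
Qed.

Lemma mring_comp1 : RG 0 1.
Proof. by have := @mring_comp_mon 0%MM 1; rewrite mondeg0 mpolyX0 scale1r. Qed.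

Lemma mring_comp_var v : RG (dx v) (mvar S v).
Proof. by have := @mring_comp_mon U_(v)%MM 1; rewrite mondegU scale1r. Qed.

Lemma mring_comp_coeff0 g (p : P) : RG g p -> p@_0%MM != 0 -> g = 0.
Proof. by move=> /mring_compP h /h <-; exact: mondeg0. Qed.

Lemma mcoeff_var v (p : P) (m : 'X_{1..N}) :
  (mvar S v * p)@_m = if m v == 0%N then 0 else p@_(m - U_(v)).
Proof.
rewrite mulrC; case: eqP => [mv|/eqP mv]; last first.
  have mE : m = (U_(v) + (m - U_(v)))%MM.
    apply/mnmP => w; rewrite mnmDE mnmBE mnm1E.
    by case: eqP => [<-|_]; rewrite ?subn0 // subnKC // lt0n.
  by rewrite {1}mE mcoeffMX.
apply/eqP; rewrite mcoeff_eq0; apply/negP => /msuppM_le /allpairsP[[m1 m2] [_ /=]].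
rewrite msuppX inE => /eqP -> mE; move: mv; rewrite mE mnmDE mnm1E eqxx.
by rewrite addn1.
Qed.

(** The quotient in the division of [p] by the variable [v]; the monomials without [v] form the
    remainder and are dropped. *)
Definition div_var v (p : P) : P :=
  \sum_(m <- msupp p | m v != 0%N) p@_m *: 'X_[m - U_(v)].

Lemma div_varE v (p : P) (m : 'X_{1..N}) : (div_var v p)@_m = p@_(m + U_(v)).
Proof.
rewrite /div_var raddf_sum /=.
under eq_bigr do rewrite mcoeffZ mcoeffX.
have mv : (m + U_(v))%MM v != 0%N by rewrite mnmDE mnm1E eqxx addn1.
have other (m' : 'X_{1..N}) : m' v != 0%N -> m' != (m + U_(v))%MM -> (m' - U_(v))%MM != m.
  move=> m'v; apply: contraNneq => <-; apply/eqP/mnmP => w; rewrite mnmDE mnmBE mnm1E.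
  by case: eqP => [<-|_]; rewrite ?subn0 ?addn0 // subnK // lt0n.
rewrite big_mkcond /=.
have [mp|mp] := boolP ((m + U_(v))%MM \in msupp p); last first.
  rewrite big_seq big1 => [|m' m'p].
    by apply/esym/eqP; rewrite mcoeff_eq0.
  case: ifP => // m'v; rewrite (negbTE (other _ m'v _)) ?mulr0 //.
  by apply: contraNneq mp => <-.
rewrite (bigD1_seq _ mp (msupp_uniq p)) /= mv addmK eqxx mulr1 [X in _ + X]big1 ?addr0 // => m' m'm.
by case: ifP => // m'v; rewrite (negbTE (other _ m'v m'm)) mulr0.
Qed.

Lemma mring_comp_div v g (p : P) : RG (g + dx v) p -> RG g (div_var v p).
Proof.
move=> /mring_compP hp; apply/mring_compP => m; rewrite div_varE => /hp.
by rewrite mondegD mondegU => /addIr.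
Qed.

Lemma div_var0 v : div_var v 0 = 0.
Proof. by apply/mpolyP => m; rewrite div_varE !mcoeff0. Qed.

(** Packaged as a submodule because membership in [irrelevant_ideal] quantifies over all submodules
    containing the variables. *)
Definition constp : {pred P^o} := fun p => (p : P)@_0%MM == 0.

Fact constp_closed : submod_closed constp.
Proof.
split=> [|a p q]; rewrite !unfold_in /= ?mcoeff0 //.
move=> /eqP p0 /eqP q0; rewrite mcoeffD q0 addr0 [a *: p]/(a * p).
have -> : (a * (p : P))@_0%MM = a@_0%MM * (p : P)@_0%MM by exact: (rmorphM (mcoeff 0%MM)).
by rewrite p0 mulr0.
Qed.
HB.instance Definition _ :=
  GRing.isSubmodClosed.Build P P^o constp constp_closed.

Lemma irrelevantP (p : P) : ((p : P^o) \in irrelevant_ideal S n) = (p@_0%MM == 0).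
Proof.
apply/asboolP/idP => [|/eqP p0 W XW].
  move=> /(_ (GRing.SubmodClosed.clone _ _ constp _)); apply => _ [v _ <-].
  by rewrite unfold_in /mvar /= mcoeffX mnm1_eq0.
rewrite [p]mpolyE big_seq; apply: rpred_sum => m mp.
have [v mv] : exists v, m v != 0%N.
  apply/existsP; apply: contraLR mp => /existsPn m0.
  have -> : m = 0%MM by apply/mnmP => v; rewrite mnm0E; apply/eqP; rewrite -[_ == _]negbK m0.
  by rewrite -mcoeff_eq0 p0.
have mE : m = ((m - U_(v)) + U_(v))%MM.
  apply/mnmP => w; rewrite mnmDE mnmBE mnm1E.
  by case: eqP => [<-|_]; rewrite ?subn0 ?addn0 // subnK // lt0n.
rewrite mE mpolyXD scalerAl.
set c := p@_ _ *: _; change ((c : P) *: (mvar S v : P^o) \in W).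
by apply: rpredZ; apply: XW; exists v.
Qed.


(** The ideal generated by the variables in [T] is a monomial ideal: membership means that no
    monomial free of [T] occurs. This is its closure under multiplication. *)
Lemma mcoeff_mul0 (T : {set 'I_N}) (p q : P) :
  (forall m : 'X_{1..N}, (forall v, v \in T -> m v = 0%N) -> p@_m = 0) ->
  forall m : 'X_{1..N}, (forall v, v \in T -> m v = 0%N) -> (p * q)@_m = 0.
Proof.
move=> pT m mT; apply/eqP; rewrite mcoeff_eq0.
apply/negP => /msuppM_le /allpairsP[[m1 m2] [/= m1p _ mE]].
move: m1p; rewrite mcoeff_msupp pT ?eqxx // => v /mT /eqP.
by rewrite mE mnmDE addn_eq0 => /andP[/eqP].
Qed.

(* Elements whose coefficients lie in the ideal generated by the variables in [T]. *)
Definition coeffs_in (T : {set 'I_N}) (A : gmod P G) (fA : gfree RG A) (x : A) : Prop :=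
  forall b (m : 'X_{1..N}), (forall v, v \in T -> m v = 0%N) -> (gcf fA b x)@_m = 0.

(** * Free modules modulo a set of variables *)

Section CoeffsIn.
Variables (A : gmod P G) (fA : gfree RG A).

Lemma coeffs_in0 T : coeffs_in T fA 0.
Proof. by move=> b m _; rewrite gcf0 mcoeff0. Qed.

Lemma coeffs_inB T x y : coeffs_in T fA x -> coeffs_in T fA y -> coeffs_in T fA (x - y).
Proof. by move=> xT yT b m mT; rewrite gcfB mcoeffB xT // yT // subrr. Qed.

Lemma coeffs_inZ T a x : coeffs_in T fA x -> coeffs_in T fA (a *: x).
Proof. by move=> xT b m mT; rewrite gcfZ mulrC; exact: mcoeff_mul0 (xT b) m mT. Qed.

Lemma coeffs_in_set0 x : coeffs_in finset.set0 fA x <-> x = 0.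
Proof.
split=> [x0|->]; last exact: coeffs_in0.
have [s ->] := gcf_sum fA x; rewrite big1 // => b _.
have -> : gcf fA b x = 0 by apply/mpolyP => m; rewrite mcoeff0; apply: x0 => v; rewrite inE.
exact: scale0r.
Qed.

Lemma coeffs_in_linear T (B : gmod P G) (fB : gfree RG B) (f : {linear A -> B}) x :
  coeffs_in T fA x -> coeffs_in T fB (f x).
Proof.
move=> xT b m mT; have [s ->] := gcf_sum fA x.
rewrite linear_sum gcf_bigsum raddf_sum big1 //= => b' _.
by rewrite linearZ gcfZ; exact: mcoeff_mul0 (xT b') m mT.
Qed.

(** Multiplication by the variable [v] shifts monomials, and for [v] outside [T] the shift does not
    affect which variables of [T] occur. *)
Lemma coeffs_in_act (T : {set 'I_N}) v x : v \notin T ->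
  coeffs_in T fA (mvar S v *: x) -> coeffs_in T fA x.
Proof.
move=> vT xT b m mT; have := xT b (m + U_(v))%MM.
rewrite gcfZ mcoeff_var mnmDE mnm1E eqxx addn1 addmK; apply=> w wT.
by rewrite mnmDE mT // mnm1E; case: eqP wT vT => // <- ->.
Qed.

Lemma coeffs_in_var (T : {set 'I_N}) v x : coeffs_in (v |: T) fA (mvar S v *: x).
Proof.
by move=> b m mT; rewrite gcfZ mcoeff_var mT // !inE eqxx.
Qed.

(** [y] is the coefficientwise quotient by the variable [v]. The remainder has only monomials free
    of [v], where the ideals of [v |: T] and of [T] impose the same condition. *)
Lemma coeffs_in_div (T : {set 'I_N}) v g x : hcomp (g + dx v) x -> coeffs_in (v |: T) fA x ->
  exists2 y, hcomp g y & coeffs_in T fA (x - mvar S v *: y).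
Proof.
move=> hx xT; have [y yE] := gcf_map fA (div_var v) x (div_var0 v).
exists y.
  apply/(gcf_hom fA) => b; rewrite yE; apply: mring_comp_div.
  by rewrite addrAC; exact: (iffLR (gcf_hom fA _ x)).
move=> b m mT; rewrite gcfB gcfZ yE mcoeffB mcoeff_var div_varE.
case: eqP => [mv|/eqP mv].
  by rewrite subr0 xT // => w; rewrite !inE => /orP[/eqP->|/mT].
have -> : (m - U_(v) + U_(v) = m)%MM.
  apply/mnmP => w; rewrite mnmDE mnmBE mnm1E.
  by case: eqP => [<-|_]; rewrite ?subn0 ?addn0 // subnK // lt0n.
exact: subrr.
Qed.

Lemma coeffs_in_setTP x :
  coeffs_in finset.setT fA x <-> forall b, (gcf fA b x)@_0%MM = 0.
Proof.
split=> [xT b|x0 b m mT]; first by apply: xT => v _; rewrite mnm0E.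
by rewrite (_ : m = 0%MM) //; apply/mnmP => v; rewrite mnm0E mT // inE.
Qed.

Lemma gfree_span x : exists l : seq (G * A),
  (forall w, w \in l -> hcomp w.1 w.2) /\ x = \sum_(w <- l) w.2.
Proof.
pose Q (y : A) := exists l : seq (G * A),
  (forall w, w \in l -> hcomp w.1 w.2) /\ y = \sum_(w <- l) w.2.
have Q0 : Q 0 by exists [::]; rewrite big_nil.
have QD y y' : Q y -> Q y' -> Q (y + y').
  move=> [l [hl ->]] [l' [hl' ->]]; exists (l ++ l'); rewrite big_cat; split=> // w.
  by rewrite mem_cat => /orP[/hl|/hl'].
have [s ->] := gcf_sum fA x; apply: (big_ind Q) => // b _.
rewrite [gcf fA b x]mpolyE scaler_suml; apply: (big_ind Q) => // m _.
set c := _ *: 'X_[m]; exists [:: (mondeg m + gdeg fA b, (c : P) *: gvec fA b)].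
split=> [w|]; last by rewrite big_seq1.
rewrite inE => /eqP -> /=; apply/(gcf_hom fA) => b'.
rewrite gcfZ gcf_vec; case: eqP => [->|_]; last by rewrite mulr0; exact: mring_comp0.
by rewrite addrK mulr1; exact: mring_comp_mon.
Qed.

(** Modulo all variables only constant terms survive, and a homogeneous element has a constant term
    at [b] only in the degree of [b]; at each [b] at most one summand contributes. *)
Lemma coeffs_in_homogeneous (r : seq G) (w : G -> A) : uniq r ->
  (forall g, hcomp g (w g)) -> coeffs_in finset.setT fA (\sum_(g <- r) w g) ->
  forall g, g \in r -> coeffs_in finset.setT fA (w g).
Proof.
move=> ur hw /coeffs_in_setTP e g gr; apply/coeffs_in_setTP => b.
have c0 h : h != gdeg fA b -> (gcf fA b (w h))@_0%MM = 0.
  move=> hb; apply: contraNeq hb => wh; rewrite -subr_eq0; apply/eqP.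
  by apply: (mring_comp_coeff0 _ wh); exact: (iffLR (gcf_hom fA _ _)).
have [gb|/c0 //] := eqVneq g (gdeg fA b).
have := e b; rewrite gcf_bigsum raddf_sum (bigD1_seq g) //= [X in _ + X]big1 ?addr0 // => h hg.
by apply: c0; rewrite -gb.
Qed.
End CoeffsIn.


(** * Tensor product with the base ring *)

Section TensorBase.
Variables (A : gmod P G) (fA : gfree RG A).

Local Notation L := (base_gmod S n).
Local Notation pr := (quotm_pi (irrelevant_ideal S n)).

(* [x |-> x (x) 1] induces the isomorphism of [A / mA] with [A (x) R/m]. *)
Definition tens1 (x : A) : tens A L := tens_pure x (pr (1 : P^o) : L).

Lemma tens1P : linear tens1.
Proof. by move=> a x y; rewrite /tens1 tens_pureDl tens_pureZl. Qed.
HB.instance Definition _ := GRing.isLinear.Build P A (tens A L) *:%R tens1 tens1P.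

Lemma tens1Z a x : tens1 (a *: x) = a *: tens1 x.
Proof. exact: tens_pureZl. Qed.

Let prZ (a : P) (p : P^o) : a *: pr p = pr (a *: p).
Proof. by rewrite linearZ. Qed.

Lemma tens1_pr x (r : P) : tens_pure x (pr (r : P^o) : L) = tens1 (r *: x).
Proof.
rewrite /tens1 tens_pureZl -tens_pureZr; congr tens_pure.
by rewrite prZ; congr pr; rewrite /GRing.scale /= mulr1.
Qed.

Lemma tens1_surj t : exists x, tens1 x = t.
Proof.
rewrite -[t]quotm_reprK; move: (repr t) => D; rewrite -(freeg_sumE D) raddf_sum.
apply: (big_ind (fun t => exists x, tens1 x = t)) => [|_ _ [x <-] [y <-]|[a l] _].
- by exists 0; rewrite raddf0.
- by exists (x + y); rewrite raddfD.
have -> : << coeff (a, l) D *g (a, l) >> = coeff (a, l) D *: tens_gen a l.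
  by apply/eqP/freeg_eqP => K; rewrite coeffZ !coeffU mul1r.
exists (coeff (a, l) D *: ((repr l : P) *: a)).
rewrite tens1Z -tens1_pr quotm_reprK.
by apply/esym; exact: (quotm_piZ (spanp (@tens_rel P A L))).
Qed.

Lemma tens1_hom g x : hcomp g x -> hcomp g (tens1 x : tensg A L).
Proof.
move=> hx; exists [:: (g, (x, pr (1 : P^o) : L))]; rewrite big_seq1; split=> // u.
rewrite inE => /eqP -> /=; split=> //; rewrite subrr.
by exists 1 => //; exact: mring_comp1.
Qed.

Lemma tens1_hom_surj g (t : tensg A L) : hcomp g t -> exists2 x, hcomp g x & tens1 x = t.
Proof.
have wA := gfree_wgr mring_comp0 mring_compB mring_compM fA.
move=> [s [hs ->]]; rewrite big_seq.
apply: (big_ind (fun t => exists2 x, hcomp g x & tens1 x = t)) => [|_ _ [x hx <-] [y hy <-]|u us].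
- by exists 0; [exact: (wgr0 wA) | rewrite raddf0].
- by exists (x + y); [exact: (wgrD wA) | rewrite raddfD].
have [hu [r hr <-]] := hs u us; exists ((r : P) *: u.2.1); last by rewrite tens1_pr.
by rewrite -[g](subrK u.1); exact: (wgrZ wA).
Qed.

Definition coeffsp : {pred A} := fun x => `[< coeffs_in finset.setT fA x >].

Fact coeffsp_closed : submod_closed coeffsp.
Proof.
split=> [|a x y]; first by apply/asboolP; exact: coeffs_in0.
move=> /asboolP xT /asboolP yT; apply/asboolP.
rewrite -[y]opprK; apply: coeffs_inB; first exact: coeffs_inZ.
by rewrite -scaleN1r; exact: coeffs_inZ.
Qed.
HB.instance Definition _ := GRing.isSubmodClosed.Build P A coeffsp coeffsp_closed.

Lemma irrelevant_coeffs (p : P) x : (p : P^o) \in irrelevant_ideal S n -> p *: x \in coeffsp.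
Proof.
rewrite irrelevantP => /eqP p0; apply/asboolP/coeffs_in_setTP => b.
rewrite gcfZ; have -> : (p * gcf fA b x)@_0%MM = p@_0%MM * (gcf fA b x)@_0%MM.
  exact: (rmorphM (mcoeff 0%MM)).
by rewrite p0 mul0r.
Qed.

(** The inverse map sends the tensor of [a] and [l] to the class of [r *: a], where [r] represents
    [l]; hence nothing beyond [coeffsp] becomes zero. *)
Lemma tens1_eq0 x : tens1 x = 0 <-> coeffs_in finset.setT fA x.
Proof.
have prI (p q : P^o) : pr p = pr q <-> p - q \in irrelevant_ideal S n by exact: quotm_piP.
split=> [|/coeffs_in_setTP x0]; last first.
  have [s ->] := gcf_sum fA x; rewrite linear_sum big1 // => b _.
  change (tens1 (gcf fA b x *: gvec fA b) = 0).
  rewrite -tens1_pr (_ : pr _ = 0); last first.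
    by rewrite -(raddf0 pr); apply/prI; rewrite subr0 irrelevantP x0.
  by rewrite -(scale0r 0) tens_pureZr scale0r.
pose h (p : A * L) : quotm coeffsp := quotm_pi coeffsp ((repr p.2 : P) *: p.1).
pose be : {linear {freeg (A * L)%type / P} -> quotm coeffsp} := free_lift h.
have beE a l : be (tens_gen a l) = h (a, l) by exact: free_lift_gen.
(* Any representative of [l] gives the same class; compatibility with the operations on [l] rests on
   this. *)
have hpr a (p : P) (l : L) : pr (p : P^o) = l -> h (a, l) = quotm_pi coeffsp (p *: a).
  move=> pl; apply/quotm_piP; rewrite -scalerBl; apply: irrelevant_coeffs.
  by apply/prI; rewrite pl quotm_reprK.
have be0 D : D \in spanp (@tens_rel P A L) -> be D = 0.
  move=> /asboolP DW; suff: D \in kerp be by move=> /eqP.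
  have pK (l : L) : pr (repr l) = l by exact: quotm_reprK.
  apply: DW => _ [a a' l|a l l'|c a l|c a l]; apply/eqP.
  - by rewrite !linearB !beE /h /= scalerDr linearD addrAC addrK subrr.
  - rewrite !linearB !beE (hpr a (repr l + repr l' : P)); last by rewrite raddfD /= !pK.
    by rewrite /h /= scalerDl linearD addrAC addrK subrr.
  - by rewrite linearB linearZ !beE /h /= scalerA mulrC -scalerA linearZ subrr.
  - rewrite linearB linearZ !beE (hpr a (c * repr l : P)); last first.
      by rewrite -[c * _]/(c *: (repr l : P^o)) -prZ pK.
    by rewrite /h /= -scalerA linearZ subrr.
rewrite /tens1 /tens_pure -(raddf0 (quotm_pi _)) => /quotm_piP; rewrite subr0 => /be0.
rewrite beE (hpr x 1) // scale1r -(raddf0 (quotm_pi _)) => /quotm_piP.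
by rewrite subr0 => /asboolP.
Qed.

End TensorBase.

(* The differential [q] out of the tensor product is kept arbitrary, to cover
   the end of the complex. *)
Lemma tens_homology_SuppP (A B : gmod P G) (C : gmod P G) (fB : gfree RG B)
    (f : {linear A -> B})
    (q : {linear tensg B (base_gmod S n) -> C}) g :
  Supp (@homology P G (tensg A (base_gmod S n)) (tensg B (base_gmod S n)) C
         (tens_map (base_gmod S n) f) q) g <->
  exists x : B, [/\ hcomp g x, q (tens1 x) = 0 &
    forall z, ~ coeffs_in finset.setT fB (x - f z)].
Proof.
have tf z : tens_map (base_gmod S n) f (tens1 z) = tens1 (f z) by exact: tens_mapE.
have tB (x y : B) : tens1 x = tens1 y <-> coeffs_in finset.setT fB (x - y).
  rewrite -tens1_eq0; have -> : tens1 (x - y) = tens1 x - tens1 y by exact: raddfB.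
  by split=> [->|/eqP]; [rewrite subrr | rewrite subr_eq0 => /eqP].
split=> [/homology_SuppP[t [ht qt nt]]|[x [hx qx nx]]].
  have [x hx xt] := tens1_hom_surj fB ht; subst t.
  exists x; split=> // z /tB e.
  by apply: (nt (tens1 z)); rewrite [LHS]tf.
apply/homology_SuppP; exists (tens1 x); split=> [||t e] //; first exact: tens1_hom.
have [z zt] := tens1_surj t; subst t.
by apply: (nx z); apply/tB; rewrite -tf.
Qed.

(** * The resolution as a group with differential *)

Section Resolution.
Variables (M : gmod P G) (F : nat -> gmod P G) (d : forall j, {linear F j.+1 -> F j}).
Variable aug : {linear F 0 -> M}.
Variable fF : forall j, gfree RG (F j).
Hypothesis M_graded : is_graded RG M.
Hypothesis d_hom : forall j, homogeneous_map (d j).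
Hypothesis aug_hom : homogeneous_map aug.
Hypothesis d_exact : forall j, homogeneously_exact (d j.+1) (d j).
Hypothesis aug_exact : homogeneously_exact (d 0) aug.
Hypothesis aug_surj : homogeneously_exact aug (\0 : {linear M -> M}).

Let fres_wgr j : weakly_graded RG (F j).
Proof. exact: (gfree_wgr mring_comp0 mring_compB mring_compM (fF j)). Qed.

(** A product rather than a direct sum: primitives are chosen independently in each [F j], without
    any finiteness. *)
Definition resolution : lmodType P := prodm F.

Definition resolution_dif (c : resolution) : resolution :=
  fun j => d j (c j.+1).

Fact resolution_dif_linear : linear resolution_dif.
Proof.
move=> a c c'; apply: functional_extensionality_dep => j.
exact: (linearP (d j) a (c j.+1) (c' j.+1)).
Qed.
HB.instance Definition _ :=
  GRing.isLinear.Build P resolution resolution *:%R resolution_dif resolution_dif_linear.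

Fact resolution_dif_dif c : resolution_dif (resolution_dif c) = 0.
Proof.
by apply: functional_extensionality_dep => j; exact: ((d_exact j).1 (c j.+2)).
Qed.

Fact resolution_dif_act v c : resolution_dif (mvar S v *: c) = mvar S v *: resolution_dif c.
Proof. exact: linearZ. Qed.

Definition resolution_dgm : dgm 'I_N :=
  @Dgm _ resolution resolution_dif (fun v => *:%R (mvar S v)) resolution_dif_dif
    resolution_dif_act (@scale_actC _ _ (@mvar S k n) resolution).

Definition resp (g : G) (c : resolution_dgm) : Prop := forall j, hcomp g (c j).

Definition resz (T : {set 'I_N}) (g : G) (c : resolution_dgm) : Prop :=
  resp g c /\ forall j, coeffs_in T (fF j) (c j).

Definition resaug (c : resolution_dgm) : module_dgm (@mvar S k n) M := aug (c 0%N).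

Fact resaug_sub : zmod_morphism resaug.
Proof. by move=> c c'; exact: (raddfB aug (c 0%N) (c' 0%N)). Qed.
HB.instance Definition _ :=
  GRing.isZmodMorphism.Build resolution_dgm (module_dgm (@mvar S k n) M) resaug resaug_sub.

Definition resa (g : G) (c : resolution_dgm) : Prop := resp g c /\ resaug c = 0.

Lemma resp_gsub : gsub dx resp.
Proof.
split=> [g j|g c c' hc hc' j|g c hc j|g v c hc j].
- exact: (wgr0 (fres_wgr j)).
- exact: (wgrB (fres_wgr j)).
- exact: d_hom.
- by rewrite addrC; apply: (wgrZ (fres_wgr j)) => //; exact: mring_comp_var.
Qed.

Lemma resaug_dif c : resaug (resolution_dif c) = 0.
Proof. exact: (aug_exact.1 (c 1%N)). Qed.

Lemma resaug_act v c : resaug (act resolution_dgm v c) = mvar S v *: (resaug c : M).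
Proof.
by change (aug (mvar S v *: c 0%N) = mvar S v *: aug (c 0%N)); rewrite linearZ.
Qed.

Lemma resa_gsub : gsub dx resa.
Proof.
split=> [g|g c c' [hc zc] [hc' zc']|g c [hc zc]|g v c [hc zc]]; split.
- exact: (gsub0 resp_gsub).
- by rewrite raddf0.
- exact: (gsubB resp_gsub).
- by rewrite raddfB /= zc zc' subrr.
- exact: (gsub_dif resp_gsub).
- exact: resaug_dif.
- exact: (gsub_act resp_gsub).
- by rewrite resaug_act zc scaler0.
Qed.

Lemma resz_gsub T : gsub dx (resz T).
Proof.
split=> [g|g c c' [hc zc] [hc' zc']|g c [hc zc]|g v c [hc zc]]; split.
- exact: (gsub0 resp_gsub).
- by move=> j; exact: coeffs_in0.
- exact: (gsubB resp_gsub).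
- by move=> j; exact: coeffs_inB.
- exact: (gsub_dif resp_gsub).
- by move=> j; exact: coeffs_in_linear.
- exact: (gsub_act resp_gsub).
- by move=> j; exact: coeffs_inZ.
Qed.

Lemma resz0 g c : resz finset.set0 g c <-> c = 0.
Proof.
split=> [[_ c0]|->]; last exact: (gsub0 (resz_gsub _)).
apply: functional_extensionality_dep => j.
exact: (iffLR (coeffs_in_set0 (fF j) (c j)) (c0 j)).
Qed.

Lemma resa_acyc g : acyc resa (resz finset.set0) g.
Proof.
move=> c [hc ac] /resz0 dc.
have ex j : exists2 z : F j.+1, hcomp g z & d j z = c j.
  case: j => [|j]; first by apply: aug_exact.2.
  by apply: (d_exact j).2 => //; exact: (congr1 (fun c : resolution => c j) dc).
have [b bP] : exists b : forall j, F j.+1, forall j, hcomp g (b j) /\ d j (b j) = c j.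
  exists (fun j => projT1 (cid2 (ex j))) => j; have := cid2 (ex j).
  by split; case: (cid2 (ex j)).
(* The primitive of [c j] lives in [F j.+1]; the value 0 at index 0 puts [b'] in the kernel of the
   augmentation. *)
pose b' : resolution := fun j => if j is j'.+1 then b j' else 0.
have hb' : resp g b'.
  by case=> [|j]; [exact: (wgr0 (fres_wgr 0)) | have [] := bP j].
exists b'; first by split=> //; exact: raddf0.
apply/resz0; apply/eqP; rewrite subr_eq0; apply/eqP.
by apply: functional_extensionality_dep => j; have [_] := bP j.
Qed.

Lemma resaug_qiso : qiso dx (resaug : {additive resolution_dgm -> module_dgm (@mvar S k n) M}) 0
  resp resa (fun g (m : module_dgm (@mvar S k n) M) => hcomp g (m : M))
  (@zerop G (module_dgm (@mvar S k n) M)).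
Proof.
split=> [g c hc|g c hc|g m hm|g c hc|g v c hc]; rewrite ?addr0.
- exact: aug_hom.
- by split=> [c0|[]].
- rewrite addr0 in hm; have [z hz zm] := aug_surj.2 g m hm erefl.
  exists (fun j => if j is 0 then z else 0); last first.
    by apply/eqP; rewrite subr_eq0; apply/eqP; exact: (esym zm).
  by case=> [|j] //; exact: (wgr0 (fres_wgr j.+1)).
- by change (resaug (resolution_dif c) - 0 = 0 :> M); rewrite resaug_dif subrr.
- change (resaug (act resolution_dgm v c) - mvar S v *: (resaug c : M) = 0 :> M).
  by rewrite resaug_act subrr.
Qed.

Lemma resz_act_reg (T : {set 'I_N}) v : v \notin T -> act_reg dx v resp (resz T) (resz (v |: T)).
Proof.
move=> vT; split=> [g x hx [_ zx]|g x [hx zx]|g x hx|g y [hy zy]].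
- by split=> // j; apply: (coeffs_in_act vT); exact: zx.
- by split=> // j b m mT; apply: zx => w wT; apply: mT; rewrite !inE wT orbT.
- by split=> [|j]; [exact: (gsub_act resp_gsub) | exact: coeffs_in_var].
have ex j := coeffs_in_div (hy j) (zy j).
have [x xP] : exists x : resolution, forall j, hcomp g (x j) /\
    coeffs_in T (fF j) (y j - mvar S v *: x j).
  exists (fun j => projT1 (cid2 (ex j))) => j.
  by split; case: (cid2 (ex j)).
have hx : resp g x by move=> j; have [] := xP j.
exists x => //; split=> [|j]; last by have [] := xP j.
by apply: (gsubB resp_gsub) => //; exact: (gsub_act resp_gsub).
Qed.

(** The equivalence of the resolution with [M] has two halves: [resaug] identifies the quotient by
    [resa] with [M], and [resa] itself is acyclic by exactness. *)
Lemma kos_resolution g : let l := enum 'I_N in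
  acyc (@kosp _ _ dx l (module_dgm (@mvar S k n) M) (fun g m => hcomp g (m : M)))
       (@kosp _ _ dx l (module_dgm (@mvar S k n) M) (@zerop G _)) g <->
  acyc resp (resz finset.setT) (g + \sum_v dx v).
Proof.
move=> l.
have gM : gsub dx (fun g (m : module_dgm (@mvar S k n) M) => hcomp g (m : M)).
  by apply: (module_gsub _ M_graded) => v; exact: mring_comp_var.
have gZ : gsub dx (@zerop G (module_dgm (@mvar S k n) M)) by exact: zerop_gsub.
have E := kos_qiso l g resp_gsub resa_gsub gM gZ resaug_qiso.
rewrite addr0 in E; rewrite -E.
have z0a : incl (resz finset.set0) resa.
  by move=> h c /resz0 ->; exact: (gsub0 resa_gsub).
have resa_p : incl resa resp by move=> h c [].
rewrite -(kos_acyc_quot (l := l) g resp_gsub resa_gsub (resz_gsub _) z0a resa_p); last first.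
  by apply: kos_acyc; [exact: resa_gsub | exact: resz_gsub | exact: resa_acyc].
rewrite (kos_regular_seq (l := l) g resp_gsub resz_gsub _ resz_act_reg) ?enum_uniq //; first last.
- by apply/allP => v _; rewrite /= inE.
- by move=> T h c [].
rewrite finset.set0U big_enum /= (_ : [set v in l]%SET = finset.setT) //.
by apply/finset.setP => v; rewrite !inE mem_enum.
Qed.


(** [Tor] with the resolution kept abstract, so that the proofs do not meet the iterates in
    [fres]. *)
Definition tor_of i : gmod P G :=
  let T j := tensg (F j) (base_gmod S n) in
  let t j : {linear T j.+1 -> T j} := tens_map (base_gmod S n) (d j) in
  match i with
  | 0 => @homology P G (T 1) (T 0) (T 0) (t 0) \0
  | j.+1 => @homology P G (T j.+2) (T j.+1) (T j) (t j.+1) (t j)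
  end.

Definition resolution_single i (x : F i) : resolution := fun j =>
  if @eqP _ i j is ReflectT e then ecast j (F j) e x else 0.

Lemma resolution_singleE i (x : F i) : resolution_single x i = x.
Proof. by rewrite /resolution_single; case: eqP => // e; rewrite eq_axiomK. Qed.

Lemma resolution_single0 i j (x : F i) : i != j -> resolution_single x j = 0.
Proof. by rewrite /resolution_single; case: eqP. Qed.

Definition tor_cycle i : F i -> Prop :=
  match i with
  | 0 => fun _ => True
  | j.+1 => fun x => coeffs_in finset.setT (fF j) (d j x)
  end.

Lemma tor_of_SuppP i g : Supp (tor_of i) g <->
  exists x : F i, [/\ hcomp g x, tor_cycle x &
    forall z, ~ coeffs_in finset.setT (fF i) (x - d i z)].
Proof.
case: i => [|i].
  rewrite [tor_of 0]/=; apply: (iff_trans (tens_homology_SuppP (fF 0) _ _ _)).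
  by split=> -[x [hx _ nx]]; exists x.
apply: (iff_trans (tens_homology_SuppP (fF i.+1) _ _ _)).
have E (x : F i.+1) : tens_map (base_gmod S n) (d i) (tens1 x) = 0 <-> tor_cycle x.
  by rewrite tens_mapE; exact: (tens1_eq0 (fF i) (d i x)).
by split=> -[x [hx /E cx nx]]; exists x.
Qed.

(** Same pattern as for Cech cohomology, modulo the variables: the components of a cycle are treated
    separately, and each primitive is made homogeneous. *)
Lemma resolution_acycP g :
  acyc resp (resz finset.setT) g <-> forall i, ~ Supp (tor_of i) g.
Proof.
split=> [aF i /tor_of_SuppP[x [hx cx nx]]|nS c hc [_ dc]].
  have hs : resp g (resolution_single x).
    move=> j; have [ij|ij] := eqVneq i j; last first.
      by rewrite resolution_single0 //; exact: (wgr0 (fres_wgr j)).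
    by subst j; rewrite resolution_singleE.
  have [|b hb [_ zb]] := aF (resolution_single x) hs.
    split=> [|j]; first exact: (gsub_dif resp_gsub).
    change (coeffs_in finset.setT (fF j) (d j (resolution_single x j.+1))).
    have [e|ij] := eqVneq i j.+1; last first.
      by rewrite resolution_single0 // raddf0; exact: coeffs_in0.
    by subst i; rewrite resolution_singleE.
  apply: (nx (b i.+1)); have := zb i.
  by rewrite -{2}(resolution_singleE x).
have ex j : exists2 z : F j.+1, hcomp g z & coeffs_in finset.setT (fF j) (c j - d j z).
  have [z zc] : exists z, coeffs_in finset.setT (fF j) (c j - d j z).
    apply: contrapT => nz; apply: (nS j); apply/tor_of_SuppP; exists (c j).
    split=> [||z zc]; [exact: hc| | by apply: nz; exists z].
    by case: (j) => //= j'; exact: dc.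
  have [l [hl zl]] := gfree_span (fF j.+1) z; subst z.
  have [] := @homogeneous_preimage G (F j.+1) (F j) (@hcomp _ _ (F j.+1)) (@hcomp _ _ (F j))
    (coeffs_in finset.setT (fF j)) (d j) _ _ _ _ _ _ g (c j) l (hc j) hl.
  - by move=> h; exact: (wgr0 (fres_wgr _)).
  - by move=> h x y; exact: (wgrD (fres_wgr _)).
  - by move=> h; exact: (wgr0 (fres_wgr _)).
  - by move=> h x y; exact: (wgrB (fres_wgr _)).
  - exact: d_hom.
  - by move=> r w ur hw; exact: coeffs_in_homogeneous.
  - exact: zc.
  by move=> z hz zc'; exists z.
have [b bP] : exists b : forall j, F j.+1, forall j, hcomp g (b j) /\
    coeffs_in finset.setT (fF j) (c j - d j (b j)).
  exists (fun j => projT1 (cid2 (ex j))) => j.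
  by split; case: (cid2 (ex j)).
pose b' : resolution := fun j => if j is j'.+1 then b j' else 0.
have hb' : resp g b'.
  by case=> [|j]; [exact: (wgr0 (fres_wgr 0)) | have [] := bP j].
exists b' => //; split=> [|j]; last by have [] := bP j.
by apply: (gsubB resp_gsub) => //; exact: (gsub_dif resp_gsub).
Qed.

End Resolution.

End Polynomials.

(** * Comparison *)

Section Comparison.
Variables (S : comNzRingType) (k : nat) (n : 'I_k -> nat).
Local Notation N := (\sum_(i < k) n i)%N.

(** Block [i] contributes [n i] copies of the [i]-th unit vector; this turns the accumulated shift
    into that of the theorem. *)
Lemma sum_vardeg : \sum_(v < N) vardeg v = \row_i (n i)%:Z.
Proof.
apply/rowP => i; rewrite summxE mxE.
rewrite (reindex (@tagnat.rank k n)) /=; last first.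
  by apply: onW_bij; exact: tagnat.rank_bij.
rewrite (eq_bigr (fun p : {i : 'I_k & 'I_(n i)} => (i == tag p)%:R)); last first.
  by move=> p _; rewrite mxE /tagnat.sig1 tagnat.rankK.
rewrite -(@sig_big_dep _ _ _ _ (fun i => 'I_(n i)) xpredT (fun _ _ => true)
  (fun i' _ => (i == i')%:R : int)) /=.
rewrite (bigD1 i) //= eqxx [X in _ + X]big1 ?addr0; last first.
  by move=> i' /negbTE; rewrite eq_sym => ->; rewrite big1.
by rewrite sumr_const card_ord; exact: (natz (n i)).
Qed.

Variable M : gmod (mring S n) 'rV[int]_k.
Hypothesis M_graded : is_graded (@mring_comp S k n) M.

Local Notation TorM := (Tor (@mring_comp S k n) M (base_gmod S n)).

(** The closure of [U] enters through the Cech side, where torsion classes are pushed to higher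
    degrees; the passage from the Koszul complex to Tor is degree by degree. *)
Lemma Tor_local_cohomology (U : 'rV[int]_k -> Prop) :
  (forall g (v : 'I_N), U g -> U (g + @vardeg k n v)) ->
  (forall g, U g -> forall i, ~ Supp (TorM i) (g + \row_i (n i)%:Z)) <->
  (forall g, U g -> forall i, ~ Supp (local_cohomology M i) g).
Proof.
move=> UU.
have xv := @mring_comp_var S k n.
have gr0 := @mring_comp0 S k n; have grB := @mring_compB S k n.
have grM := @mring_compM S k n; have gr1 := @mring_comp1 S k n.
have fF j := @fres_gfree _ _ (@mring_comp S k n) M j.
have HT i : TorM i = tor_of (fres_d (@mring_comp S k n) M) i by case: i.
have dh j : homogeneous_map (fres_d (@mring_comp S k n) M j).
  exact (@fres_d_hom _ _ _ gr0 grB grM M j).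
have ah : homogeneous_map (fres_aug (@mring_comp S k n) M).
  exact (@fres_aug_hom _ _ _ gr0 grB grM M M_graded).
have de j := @fres_d_exact _ _ _ gr0 gr1 M j.
have ae := @fres_aug_exact _ _ _ gr0 gr1 M.
have au := @fres_aug_surj _ _ _ gr0 gr1 M.
have kosE := kos_resolution fF M_graded dh ah de ae au.
have torE := resolution_acycP fF dh de.
have cubeE := cube_kos xv M_graded UU.
have cohE := cube_acycP xv M_graded.
split=> H.
  have := (iffRL cubeE _) => H1 g Ug; apply/cohE; apply: H1 => // h Uh.
  by apply/kosE; rewrite sum_vardeg; apply/torE => i; rewrite -HT; exact: H.
have := (iffLR cubeE _) => H1 g Ug i; rewrite HT; move: i; apply/torE.
rewrite -sum_vardeg; apply/kosE; apply: H1 => // h Uh.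
by apply/cohE; exact: H.
Qed.

End Comparison.

Local Open Scope classical_set_scope.

Theorem theorem1p2 (S : comNzRingType) (k : nat) (n : 'I_k -> nat)
    (k_gt0 : (0 < k)%N) (n_gt0 : forall i, (0 < n i)%N)
    (M : gmod (mring S n) 'rV[int]_k)
    (M_graded : is_graded (@mring_comp S k n) M) :
  \bigcup_i estar (Supp (Tor (@mring_comp S k n) M (base_gmod S n) i)) =
  translate (\row_i (n i)%:Z) (estar (cohomology_supp M)).
Proof.
set nu := \row_i (n i)%:Z.
apply/seteqP; split=> e.
(* [U] is [e - nu + NN^k]: [e] lies in the left side when some Tor is nonzero on [nu + U], and in
   the right side when some local cohomology is nonzero on [U]. Both inclusions follow by
   contraposition. *)
all: pose U (h : 'rV[int]_k) := forall j, 0 <= (h + nu - e) 0 j.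
all: have UU h (v : 'I_(\sum_(i < k) n i)) : U h -> U (h + @vardeg k n v) by
  move=> Uh j; rewrite (addrAC h) (addrAC (h + nu)) mxE;
  apply: Num.Theory.addr_ge0; [exact: Uh | rewrite mxE; exact: Num.Theory.ler0n].
all: have [torN cohN] := Tor_local_cohomology M_graded UU.
- move=> [i _ [a ha [mu hmu ae]]]; apply: contrapT => ne.
  have aE : a = e + mu by rewrite -ae subrK.
  apply: (cohN _ (a - nu) _ i); last by rewrite subrK.
    move=> h Uh i' hi'; apply: ne; exists (e - nu); last by rewrite addrC subrK.
    exists h; first by exists i'.
    exists (h + nu - e); first exact: Uh.
    by rewrite opprB addrCA opprD [h + _]addrA subrr add0r.
  by move=> j; rewrite subrK aE [e + mu]addrC addrK.
- move=> [_ [h [i _ hi] [mu hmu <-]] he]; apply: contrapT => ne.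
  apply: (torN _ h _ i) => //.
    move=> h' Uh' i' hi'; apply: ne; exists i' => //; exists (h' + nu) => //.
    by exists (h' + nu - e) => //; rewrite opprB addrC subrK.
  by move=> j; rewrite -he opprD addrA addrK opprB addrC subrK.
Qed.
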